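(* Let $k\ge 2$ and let $G=\mathbb{F}(k)$ be the free non-abelian group on $k$ generators $a_1,\dots,a_k$, with word length function $\ell$ with respect to the alphabet $\{a_1^{\pm1},\dots,a_k^{\pm1}\}$. For $n\ge0$ let $B_n=\{g\in G:\ell(g)\le n\}$ and $\chi_{B_n}(t)=|B_n\cap tB_n|/|B_n|$. Then $\chi_{B_n}$ converges point-wise on $G$ as $n\to\infty$ to the function $\chi$ given, for $m\in\mathbb{N}_0$, by $$\chi(t)=\frac{1}{(2k-1)^m}\ \text{ if }\ell(t)=2m,\qquad \chi(t)=\frac{1}{k(2k-1)^m}\ \text{ if }\ell(t)=2m+1.$$ Consequently, if $G$ acts by $*$-automorphisms $\alpha_g$ on an injective von Neumann algebra $\mathcal{R}$ on a Hilbert space $H$, there is a unital completely positive $\Psi(\mathcal{R})$-bimodular mapping $\sigma:B(H\otimes\ell_2(G))\to\mathcal{L}(\mathcal{R},\alpha,G)$ with $\sigma(L_g\Psi(r))=\chi(g)L_g\Psi(r)$ for all $g\in G$, $r\in\mathcal{R}$.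
   Context: Let $\lambda_g$ be the left translation unitaries on $\ell_2(G)$, $\lambda_g\delta_h=\delta_{gh}$, and $(e_{(g,h)})_{g,h\in G}$ the canonical matrix units of $B(\ell_2(G))$. Define $L_g:=I_H\otimes\lambda_g$ and the normal faithful representation $\Psi(r):=\sum_{g\in G}\alpha_{g^{-1}}(r)\otimes e_{(g,g)}$ of $\mathcal{R}$ on $H\otimes\ell_2(G)$. The crossed product von Neumann algebra $\mathcal{L}(\mathcal{R},\alpha,G)$ is the ultra-weak closure of $\mathrm{span}\{L_g\Psi(r): g\in G, r\in\mathcal{R}\}$ in $B(H\otimes\ell_2(G))$. $\Psi(\mathcal{R})$-bimodular means $\sigma(\Psi(r)x\Psi(s))=\Psi(r)\sigma(x)\Psi(s)$ for $r,s\in\mathcal{R}$. *)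

(* Defs.v *)
From HB Require Import structures.
From mathcomp Require Import all_boot all_order all_algebra.
From mathcomp Require Import finmap.
From mathcomp Require Import complex.
From mathcomp Require Import all_classical all_reals all_analysis.
From mathcomp.analysis.showcase Require summability.
From mathcomp Require Import ring lra.
Set Implicit Arguments.
Unset Strict Implicit.
Unset Printing Implicit Defensive.
Import Order.TTheory GRing.Theory Num.Theory.
Import numFieldNormedType.Exports.

Section FreeGroup.
Variable k : nat.

(* (i, true) stands for the generator a_i and (i, false) for its inverse;
   elements of the free group are the reduced words. *)
Definition letter : Type := ('I_k * bool)%type.
HB.instance Definition _ := Finite.on letter.

Definition linv (x : letter) : letter := (x.1, ~~ x.2).

Definition reduced : pred (seq letter) := sorted (fun x y => y != linv x).

Record free_group := FreeGroup { fg_word :> seq letter; _ : reduced fg_word }.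
HB.instance Definition _ := [isSub for fg_word].
HB.instance Definition _ := [Choice of free_group by <:].

Definition lcons (x : letter) (s : seq letter) :=
  if s is y :: s' then if y == linv x then s' else x :: s else [:: x].
Definition wmul (u v : seq letter) := foldr lcons v u.
Definition winv (u : seq letter) := rev (map linv u).

Lemma linvK : involutive linv.
Proof. by case=> i b; rewrite /linv /= negbK. Qed.

Lemma reduced_tail x s : reduced (x :: s) -> reduced s.
Proof. exact: path_sorted. Qed.

Lemma lcons_reduced x s : reduced s -> reduced (lcons x s).
Proof.
case: s => [//|y s] rs /=; case: ifP => [_|yx]; first exact: reduced_tail rs.
by rewrite /reduced /= yx.
Qed.

Lemma wmul_reduced u v : reduced v -> reduced (wmul u v).
Proof. by move=> rv; elim: u => //= x u; exact: lcons_reduced. Qed.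

Lemma winv_reduced u : reduced u -> reduced (winv u).
Proof.
rewrite /winv /reduced rev_sorted sorted_map.
apply: sub_sorted => x y /=; apply: contraNN => /eqP->.
by rewrite linvK.
Qed.

Lemma lconsK x s : reduced s -> lcons x (lcons (linv x) s) = s.
Proof.
case: s => [|y s] rs /=; first by rewrite eqxx.
rewrite linvK; case: eqP => [yx|_] /=; last by rewrite eqxx.
case: s rs => [|z s] /=; first by rewrite yx.
by rewrite /reduced /= => /andP[]; rewrite yx => /negbTE->.
Qed.

Lemma wmul_lcons x v w : reduced w -> wmul (lcons x v) w = lcons x (wmul v w).
Proof.
case: v => [//|y v] rw /=; case: eqP => [->|//].
by rewrite lconsK // wmul_reduced.
Qed.

Lemma wmulA u v w : reduced w -> wmul u (wmul v w) = wmul (wmul u v) w.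
Proof. by move=> rw; elim: u => //= x u ->; rewrite wmul_lcons. Qed.

Lemma wmulu0 u : reduced u -> wmul u [::] = u.
Proof.
elim: u => //= x u IHu rxu; rewrite IHu ?(reduced_tail rxu) //.
by case: u rxu {IHu} => //= y u /andP[/negbTE->].
Qed.

Lemma wmulV u : wmul (winv u) u = [::].
Proof.
elim: u => //= x u IHu; rewrite /winv /= rev_cons /wmul foldr_rcons /=.
by rewrite linvK eqxx.
Qed.

Lemma winvK u : winv (winv u) = u.
Proof. by rewrite /winv map_rev revK -map_comp map_id_in // => x _; exact: linvK. Qed.

Definition fg_one := FreeGroup (isT : reduced [::]).
Definition fg_mul (u v : free_group) := FreeGroup (wmul_reduced u (valP v)).
Definition fg_inv (u : free_group) := FreeGroup (winv_reduced (valP u)).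

Fact fg_mulA : associative fg_mul.
Proof. by move=> u v w; apply/val_inj/wmulA/valP. Qed.
Fact fg_mul1 : left_id fg_one fg_mul.
Proof. by move=> u; apply/val_inj. Qed.
Fact fg_mulr1 : right_id fg_one fg_mul.
Proof. by move=> u; apply/val_inj/wmulu0/valP. Qed.
Fact fg_mulV : left_inverse fg_one fg_inv fg_mul.
Proof. by move=> u; apply/val_inj/wmulV. Qed.
Fact fg_mulrV : right_inverse fg_one fg_inv fg_mul.
Proof. by move=> u; apply/val_inj; rewrite /= -{1}[fg_word u]winvK wmulV. Qed.

HB.instance Definition _ :=
  isGroup.Build free_group fg_mulA fg_mul1 fg_mulr1 fg_mulV fg_mulrV.

Local Open Scope group_scope.

Definition fg_gen (i : 'I_k) : free_group :=
  FreeGroup (isT : reduced [:: (i, true)]).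

Definition fg_letter (x : letter) : free_group :=
  if x.2 then fg_gen x.1 else (fg_gen x.1)^-1.

Definition is_product_of_letters (g : free_group) (n : nat) : bool :=
  [exists w : n.-tuple letter, g == \prod_(x <- w) fg_letter x].

Fact word_length_ex g : exists n, is_product_of_letters g n.
Proof.
exists (size (fg_word g)); apply/existsP; exists (in_tuple (fg_word g)) => /=.
case: g => s rs; apply/eqP/val_inj => /=.
elim: s rs => [|x s IHs] rxs; first by rewrite big_nil.
rewrite big_cons.
have -> : fg_letter x = FreeGroup (isT : reduced [:: x]).
  by case: x {IHs rxs} => i [] //; apply/val_inj.
rewrite /= -IHs ?(reduced_tail rxs) //.
by case: s rxs {IHs} => //= y s /andP[/negbTE->].
Qed.

Definition word_length (g : free_group) : nat := ex_minn (word_length_ex g).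

End FreeGroup.

Local Open Scope classical_set_scope.
Local Open Scope ring_scope.

(* Naming the numFieldType instance of R[i] keeps [reverse_coercion] out of the
   structures below, where it would block rewriting. *)
Local Notation complex_field R := (complex_complex__canonical__Num_NumField R).

HB.mixin Record CompleteNormedModule_isHilbert (R : realType) H
    & CompleteNormedModule (complex_field R) H := {
  inner : H -> H -> R[i];
  innerP : forall (a : R[i]) (x y z : H),
    inner (a *: x + y) z = a * inner x z + inner y z;
  innerC : forall x y : H, inner x y = (inner y x)^*;
  inner_norm : forall x : H, inner x x = `|x| ^+ 2
}.

#[short(type="hilbertType")]
HB.structure Definition Hilbert (R : realType) :=
  {H of CompleteNormedModule (complex_field R) H & CompleteNormedModule_isHilbert R H}.

Notation "''[' x , y ]" := (inner x y) : ring_scope.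

Section InnerTheory.
Variables (R : realType) (H : hilbertType R).
Implicit Types (a : R[i]) (x y z : H).

Lemma innerDl x y z : '[x + y, z] = '[x, z] + '[y, z].
Proof. by have := innerP 1 x y z; rewrite scale1r mul1r. Qed.

Lemma inner0l z : '[0 : H, z] = 0.
Proof. by apply: (addIr '[0 : H, z]); rewrite -innerDl !add0r. Qed.

Lemma innerZl a x z : '[a *: x, z] = a * '[x, z].
Proof. by rewrite -[a *: x]addr0 innerP inner0l addr0. Qed.

Lemma innerDr x y z : '[x, y + z] = '[x, y] + '[x, z].
Proof. by rewrite innerC innerDl rmorphD /= -!innerC. Qed.

Lemma innerZr a x z : '[x, a *: z] = a^* * '[x, z].
Proof. by rewrite innerC innerZl rmorphM /= -!innerC. Qed.

Lemma inner_polarization x y : '[x, y] =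
  4^-1 * `|x + y| ^+ 2 + (- 4^-1 * `|x + - 1 *: y| ^+ 2 +
    ('i * 4^-1 * `|x + 'i *: y| ^+ 2 + - 'i * 4^-1 * `|x + - 'i *: y| ^+ 2)).
Proof.
rewrite -!inner_norm !(innerDl, innerDr, innerZl, innerZr).
rewrite conjCN1 rmorphN /= conjCi.
have i2 : 'i * 'i = - 1 :> R[i] by rewrite -expr2 sqrCi.
set a := '[x, x]; set b := '[x, y]; set c := '[y, x]; set d := '[y, y].
rewrite -[LHS](@mulKf _ 4) ?pnatr_eq0 //.
transitivity (4^-1 * (2 * b + 2 * c - ('i * 'i) * (2 * b) + 'i * 'i * (2 * c))).
  by rewrite i2; ring.
ring.
Qed.

End InnerTheory.

Section InnerProductNorm.
Variables (R : realType) (V : lmodType R[i]) (f : V -> V -> R[i]).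
Hypothesis fP : forall a x y z, f (a *: x + y) z = a * f x z + f y z.
Hypothesis fC : forall x y, f x y = (f y x)^*.
Hypothesis f_ge0 : forall x, 0 <= f x x.
Hypothesis f_eq0 : forall x, f x x = 0 -> x = 0.

Let f0l z : f 0 z = 0.
Proof. by have := fP (-1) 0 0 z; rewrite scaleN1r addrC subrr mulN1r addrC subrr. Qed.
Let fD x y z : f (x + y) z = f x z + f y z.
Proof. by have := fP 1 x y z; rewrite scale1r mul1r. Qed.
Let fZ a x z : f (a *: x) z = a * f x z.
Proof. by have := fP a x 0 z; rewrite !(addr0, f0l). Qed.
Let fDr x y z : f x (y + z) = f x y + f x z.
Proof. by rewrite fC fD rmorphD /= -!fC. Qed.
Let fZr a x z : f x (a *: z) = a^* * f x z.
Proof. by rewrite fC fZ rmorphM /= -!fC. Qed.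

Lemma inner_CauchySchwarz x y : `|f x y| ^+ 2 <= f x x * f y y.
Proof.
have [yy0|yy0] := eqVneq (f y y) 0.
  by rewrite yy0 mulr0 fC (f_eq0 yy0) f0l rmorph0 normr0 expr0n.
set z := f y y *: x + (- f x y) *: y.
have : 0 <= f z z by exact: f_ge0.
rewrite !(fD, fDr, fZ, fZr) rmorphN /= -!fC => h.
have {h} : 0 <= f y y * (f x x * f y y - f x y * f y x).
  by move: h; congr (0 <= _); ring.
by rewrite (fC y x) -normCK pmulr_rge0 ?subr_ge0 // lt0r yy0 f_ge0.
Qed.

Definition norm_of_inner x : R[i] := sqrtC (f x x).

Lemma ler_norm_of_innerD x y :
  norm_of_inner (x + y) <= norm_of_inner x + norm_of_inner y.
Proof.
rewrite /norm_of_inner -(@ler_pXn2r _ 2) ?nnegrE ?addr_ge0 ?sqrtC_ge0 //.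
rewrite sqrtCK sqrrD !sqrtCK !(fD, fDr) -addrA -[leRHS]addrA lerD2l addrA lerD2r.
have le_xy : `|f x y| <= sqrtC (f x x) * sqrtC (f y y).
  rewrite -(@ler_pXn2r _ 2) ?nnegrE ?mulr_ge0 ?sqrtC_ge0 //.
  by rewrite exprMn !sqrtCK inner_CauchySchwarz.
have -> : f x y + f y x = 'Re (f x y) *+ 2.
  by rewrite (fC y x) ReE -mulr_natr divfK ?pnatr_eq0.
by rewrite lerMn2r /=; apply: le_trans le_xy; rewrite leif_Re_Creal.
Qed.

Lemma norm_of_innerZ a x : norm_of_inner (a *: x) = `|a| * norm_of_inner x.
Proof.
apply/eqP; rewrite /norm_of_inner -(@eqrXn2 _ 2) ?mulr_ge0 ?sqrtC_ge0 //.
by rewrite exprMn !sqrtCK fZ fZr mulrA normCK.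
Qed.

Lemma norm_of_inner_eq0 x : norm_of_inner x = 0 -> x = 0.
Proof. by move=> x0; apply: f_eq0; rewrite -[f x x]sqrtCK -/(norm_of_inner x) x0 expr0n. Qed.

End InnerProductNorm.

Section ComplexComplete.
Variable R : realType.

(* R[i]^o already has an completeness instance keyed on realType,
   so the Hilbert space structure of the complex line is put on R[i] itself. *)
HB.instance Definition _ := NormedModule.copy R[i] R[i]^o.

Fact complex_complete (F : set_system R[i]) :
  ProperFilter F -> cauchy F -> cvg F.
Proof.
move=> FF /cauchyP Fc.
have cvgF (p : R[i] -> R) : (forall x y, `|p x - p y|%:C%C <= `|x - y|) ->
    exists l : R, p x @[x --> F] --> l.
  move=> p1; apply/cvg_ex; apply: (@cauchy_cvg R); apply: cauchy_exP => e e0.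
  have [z Fz] := Fc e%:C%C (ltac:(by rewrite ltcR)).
  exists (p z); rewrite /fmap /mkset; apply: (@filterS _ F _ _ _ _ Fz) => w.
  rewrite -!ball_normE /= => zw.
  by rewrite -ltcR; apply: le_lt_trans (p1 _ _) zw.
have normi : `|'i%C : R[i]| = 1.
  by rewrite normc_def /= expr0n expr1n add0r sqrtr1.
have [|a Fa] := cvgF (@complex.Re R).
  by move=> x y; rewrite -raddfB normc_ge_Re.
have [|b Fb] := cvgF (@complex.Im R).
  move=> x y; rewrite -raddfB /= -normrN -ReiNIm (le_trans (normc_ge_Re _)) //.
  by rewrite normrM normi mulr1.
apply/cvg_ex; exists (a +i* b)%C.
apply/cvgrPdist_lt => e e0.
have [e' e'0 ee'] : exists2 e' : R, 0 < e' & e = (e' + e')%:C%C.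
  move: e0; case: e => r s; rewrite ltcE /= => /andP[/eqP-> r0].
  by exists (r / 2); [exact: divr_gt0 | rewrite -splitr].
near=> z.
have az : `|a - complex.Re z| < e' by near: z; exact: cvgr_dist_lt.
have bz : `|b - complex.Im z| < e' by near: z; exact: cvgr_dist_lt.
rewrite [X in `|X|]complexE (le_lt_trans (ler_normD _ _)) // normrM.
have normR (r : R) : `|r%:C%C| = `|r|%:C%C.
  by rewrite normc_def /= expr0n addr0 sqrtr_sqr.
rewrite !normR normi mul1r ee' rmorphD /=.
by apply: ltrD; rewrite ltcR; case: (z) az bz.
Unshelve. all: by end_near.
Qed.

HB.instance Definition _ := Uniform_isComplete.Build R[i] complex_complete.

Let mulJP (a : R[i]) (x y z : R[i]) :
  (a *: x + y) * z^* = a * (x * z^*) + y * z^*.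
Proof. by rewrite mulrDl mulrA. Qed.
Let mulJC (x y : R[i]) : x * y^* = (y * x^*)^*.
Proof. by rewrite rmorphM /= conjCK mulrC. Qed.
Let mulJ_norm (x : R[i]) : x * x^* = `|x| ^+ 2.
Proof. by rewrite -normCK. Qed.

HB.instance Definition _ :=
  CompleteNormedModule_isHilbert.Build R R[i] mulJP mulJC mulJ_norm.

End ComplexComplete.

#[local] Existing Instance summability.totally_filter.

Section UnconditionalSum.
Variables (R : realType) (I : choiceType).
Local Notation C := R[i].
Local Notation totally := (@summability.totally I).

(* Unconditional sum: limit along the net of finite subsets of I. *)
Definition usum (f : I -> C) : C := lim (\sum_(i <- A) f i @[A --> totally]).

Definition ucvg (f : I -> C) := cvg (\sum_(i <- A) f i @[A --> totally]).

Lemma usum_cvg f : ucvg f -> \sum_(i <- A) f i @[A --> totally] --> usum f.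
Proof. by []. Qed.

Lemma usum_unique f (l : C) :
  \sum_(i <- A) f i @[A --> totally] --> l -> ucvg f /\ usum f = l.
Proof. by move=> fl; split; [exact: cvgP fl | exact: (cvg_lim (@norm_hausdorff _ C))]. Qed.

Lemma usumP (a : C) (f g : I -> C) : ucvg f -> ucvg g ->
  ucvg (fun i => a * f i + g i) /\
  usum (fun i => a * f i + g i) = a * usum f + usum g.
Proof.
move=> cf cg; apply: usum_unique.
under eq_fun do rewrite big_split -mulr_sumr /=.
apply: cvgD (usum_cvg cg).
by apply: (@cvgZl_tmp _ R[i]); exact: usum_cvg.
Qed.

Lemma usumJ (f : I -> C) : ucvg f ->
  ucvg (fun i => (f i)^*) /\ usum (fun i => (f i)^*) = (usum f)^*.
Proof.
move=> /usum_cvg/cvgrPdist_lt cf; apply: usum_unique.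
apply/cvgrPdist_lt => e e0; near=> A.
rewrite -rmorph_sum -rmorphB norm_conjC; near: A; exact: cf.
Unshelve. all: by end_near.
Qed.

Lemma ge0_usum (f : I -> C) (M : C) : (forall i, 0 <= f i) ->
  (forall A : {fset I}, \sum_(i <- A) f i <= M) ->
  [/\ ucvg f, forall A : {fset I}, \sum_(i <- A) f i <= usum f & usum f <= M].
Proof.
move=> f0 fM.
have sumR (A : {fset I}) : \sum_(i <- A) f i = (complex.Re (\sum_(i <- A) f i))%:C%C.
  by rewrite RRe_real // realE sumr_ge0.
pose S := [set complex.Re (\sum_(i <- A) f i) | A in [set: {fset I}]].
have M0 : 0 <= M by apply: le_trans (fM fset0); apply: sumr_ge0.
have supS : has_sup S.
  split; first by exists (complex.Re (\sum_(i <- fset0) f i)); exists fset0.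
  exists (complex.Re M) => _ [A _ <-]; have := fM A.
  by rewrite lecE => /andP[].
have le_sup (A : {fset I}) : \sum_(i <- A) f i <= (sup S)%:C%C.
  by rewrite sumR lecR; apply: ub_le_sup; [case: supS | exists A].
have cvgS : \sum_(i <- A) f i @[A --> totally] --> ((sup S)%:C%C : C).
  apply/cvgrPdist_lt => e; case: e => r s; rewrite ltcE /= => /andP[/eqP-> r0].
  have [_ [A _ <-] rA] := sup_adherent r0 supS.
  exists A => // B /= AB.
  rewrite ger0_norm ?subr_ge0 // sumR -rmorphB ltcR ltrBlDl -ltrBlDr.
  apply: lt_le_trans rA _; rewrite -lecR -!sumR.
  rewrite [leRHS](big_fsetID _ (mem A)) /=.
  rewrite (_ : [fset x in B | x \in A]%fset = A) ?lerDl ?sumr_ge0 //.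
  by apply/fsetP => x; rewrite !inE andb_idl //; exact: (fsubsetP AB).
have [cf ->] := usum_unique cvgS; split=> //.
rewrite -[M]RRe_real ?realE ?M0 // lecR; apply: ge_sup; first by case: supS.
by move=> _ [A _ <-]; have := fM A; rewrite lecE => /andP[].
Qed.

End UnconditionalSum.

Section L2.
Variables (R : realType) (I : choiceType) (H : hilbertType R).
Local Notation C := R[i].

Definition square_summable : {pred I -> H} :=
  [pred x | `[< exists M : C, forall A : {fset I}, \sum_(i <- A) `|x i| ^+ 2 <= M >]].

Fact square_summable_closed : submod_closed square_summable.
Proof.
split=> [|a x y].
  by apply/asboolP; exists 0 => A; rewrite big1 // => i _; rewrite normr0 expr0n.
move=> /asboolP[M xM] /asboolP[N yN]; apply/asboolP.
exists (2 * `|a| ^+ 2 * M + 2 * N) => A.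
apply: (@le_trans _ _ (\sum_(i <- A) (2 * `|a| ^+ 2 * `|x i| ^+ 2 + 2 * `|y i| ^+ 2))).
  apply: ler_sum => i _.
  have : 0 <= (`|a| * `|x i| - `|y i|) ^+ 2 by rewrite real_exprn_even_ge0 // realB ?realM ?normr_real.
  move=> h.
  apply: (@le_trans _ _ ((`|a| * `|x i| + `|y i|) ^+ 2)).
    by rewrite ler_pXn2r ?nnegrE ?addr_ge0 ?mulr_ge0 // -normrZ ler_normD.
  by rewrite -subr_ge0; move: h; congr (0 <= _); ring.
by rewrite big_split -!mulr_sumr lerD // ler_wpM2l //.
Qed.

HB.instance Definition _ :=
  GRing.isSubmodClosed.Build C (I -> H) square_summable square_summable_closed.

Record l2 := L2 { l2_fun :> I -> H; l2P : l2_fun \in square_summable }.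

HB.instance Definition _ := [isSub for l2_fun].
HB.instance Definition _ := [Choice of l2 by <:].
HB.instance Definition _ := [SubChoice_isSubLmodule of l2 by <:].

Lemma l2_bounded (x : l2) :
  exists M : C, forall A : {fset I}, \sum_(i <- A) `|x i| ^+ 2 <= M.
Proof. by have /asboolP := l2P x. Qed.

Definition l2_inner (x y : l2) : C := usum (fun i => '[x i, y i]).

Let ucvg_sqr (x : l2) : ucvg (fun i => `|x i| ^+ 2 : C).
Proof.
have [M xM] := l2_bounded x.
by have [] := ge0_usum (fun i => exprn_ge0 2 (normr_ge0 (x i))) xM.
Qed.

Let l2_innerxx x : l2_inner x x = usum (fun i => `|x i| ^+ 2 : C).
Proof. by congr usum; apply/funext => i; exact: inner_norm. Qed.

Let sum_sqr_le (x : l2) (A : {fset I}) :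
  \sum_(i <- A) `|x i| ^+ 2 <= l2_inner x x.
Proof.
have [M xM] := l2_bounded x; rewrite l2_innerxx.
by have [_] := ge0_usum (fun i => exprn_ge0 2 (normr_ge0 (x i))) xM.
Qed.

Let inner_sqr_le (x : l2) (M : C) :
  (forall A : {fset I}, \sum_(i <- A) `|x i| ^+ 2 <= M) -> l2_inner x x <= M.
Proof.
move=> xM; rewrite l2_innerxx.
by have [_ _] := ge0_usum (fun i => exprn_ge0 2 (normr_ge0 (x i))) xM.
Qed.

Lemma l2_ucvg (x y : l2) : ucvg (fun i => '[x i, y i]).
Proof.
rewrite (funext (fun i => inner_polarization (x i) (y i))).
have cZ a : ucvg (fun i => `|x i + a *: y i| ^+ 2 : C).
  exact: (@ucvg_sqr (x + a *: y)).
have cM (a : C) (f : I -> C) : ucvg f -> ucvg (fun i => a * f i).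
  move=> cf; have [+ _] := usumP a cf (@ucvg_sqr 0).
  by congr ucvg; apply/funext => i; rewrite normr0 expr0n addr0.
have c1 := @ucvg_sqr (x + y).
have c4 := cM (- 'i * 4^-1) _ (cZ (- 'i)).
have c3 := (usumP ('i * 4^-1) (cZ 'i) c4).1.
have c2 := (usumP (- 4^-1) (cZ (- 1)) c3).1.
exact: (usumP 4^-1 c1 c2).1.
Qed.

Let l2_innerP a (x y z : l2) :
  l2_inner (a *: x + y) z = a * l2_inner x z + l2_inner y z.
Proof.
rewrite -(usumP a (@l2_ucvg x z) (@l2_ucvg y z)).2.
by congr usum; apply/funext => i; rewrite -innerP.
Qed.

Let l2_innerC (x y : l2) : l2_inner x y = (l2_inner y x)^*.
Proof.
rewrite -(usumJ (@l2_ucvg y x)).2.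
by congr usum; apply/funext => i; rewrite -innerC.
Qed.

Let l2_inner_ge0 (x : l2) : 0 <= l2_inner x x.
Proof. by apply: le_trans (sum_sqr_le x fset0); apply: sumr_ge0. Qed.

Let l2_coord_le (x : l2) i : `|x i| ^+ 2 <= l2_inner x x.
Proof. by have := sum_sqr_le x [fset i]%fset; rewrite big_seq_fset1. Qed.

Let l2_inner_eq0 (x : l2) : l2_inner x x = 0 -> x = 0.
Proof.
move=> x0; apply/val_inj/funext => i /=.
apply/eqP; rewrite -normr_eq0 -sqrf_eq0 eq_le exprn_ge0 // andbT.
by rewrite -x0 l2_coord_le.
Qed.

HB.instance Definition _ := @Lmodule_isNormed.Build (complex_field R) l2 (norm_of_inner l2_inner)
  (ler_norm_of_innerD l2_innerP l2_innerC l2_inner_ge0 l2_inner_eq0)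
  (norm_of_innerZ l2_innerP l2_innerC l2_inner_ge0)
  (norm_of_inner_eq0 l2_inner_eq0).

Let l2_inner_norm (x : l2) : l2_inner x x = `|x| ^+ 2.
Proof. by change (l2_inner x x = norm_of_inner l2_inner x ^+ 2); rewrite sqrtCK. Qed.

Let cvg_ge0_le (T : Type) (F : set_system T) (f : T -> C) (l M : C) :
  ProperFilter F -> 0 <= l -> 0 <= M -> f t @[t --> F] --> l ->
  (\forall t \near F, f t <= M) -> l <= M.
Proof.
move=> FF l0 M0 /cvgrPdist_lt fl fM.
rewrite -[l]RRe_real ?realE ?l0 // -[M]RRe_real ?realE ?M0 // lecR leNgt.
apply/negP => Ml.
have e0 : 0 < (complex.Re l - complex.Re M)%:C%C by rewrite ltcR subr_gt0.
have [t [ftM ltf]] := @filter_ex _ F FF _ (filterI fM (fl _ e0)).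
have := le_lt_trans (normc_ge_Re _) ltf; rewrite ltcR raddfB /=.
apply/negP; rewrite -leNgt; apply: le_trans (ler_norm _); rewrite lerD2l lerN2.
by move: ftM; rewrite lecE => /andP[].
Qed.

Fact l2_complete (F : set_system l2) : ProperFilter F -> cauchy F -> cvg F.
Proof.
move=> FF /cauchyP Fc.
have coord_lip (x y : l2) i : `|x i - y i| <= `|x - y|.
  rewrite -(@ler_pXn2r _ 2) ?nnegrE //.
  by rewrite -l2_inner_norm; exact: l2_coord_le (x - y) i.
have /choice[l Fl] i : exists l : H, x i @[x --> F] --> l.
  apply/cvg_ex; apply: (@cauchy_cvg H); apply: cauchy_exP => e e0.
  have [x Fx] := Fc e e0.
  exists (x i); rewrite /fmap /mkset; apply: (@filterS _ F _ _ _ _ Fx) => y.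
  by rewrite -!ball_normE /=; exact: le_lt_trans.
have key (x : l2) (e : C) : 0 < e -> F (ball x e) ->
    forall A : {fset I}, \sum_(i <- A) `|x i - l i| ^+ 2 <= e ^+ 2.
  move=> e0 Fx A; apply: (@cvg_ge0_le _ F (fun y => \sum_(i <- A) `|x i - y i| ^+ 2)).
  - by apply: sumr_ge0 => i _; rewrite exprn_ge0.
  - by rewrite exprn_ge0 // ltW.
  - apply: cvg_big => [|i _]; first exact: add_continuous.
    apply: cvgM; apply: cvg_norm; (apply: cvgB; [exact: cvg_cst | exact: Fl]).
  - apply: filterS Fx => y; rewrite -ball_normE /= => xy.
    apply: le_trans (sum_sqr_le (x - y) A) _.
    by rewrite l2_inner_norm ler_pXn2r ?nnegrE // ltW.
have xl_sqr (x : l2) (e : C) : 0 < e -> F (ball x e) ->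
    (fun i => x i - l i) \in square_summable.
  by move=> e0 Fx; apply/asboolP; exists (e ^+ 2); exact: key.
have lP : l \in square_summable.
  have [x Fx] := Fc 1 ltr01.
  have -> : l = l2_fun x - (fun i => x i - l i).
    by apply/funext => i; rewrite !fctE subKr.
  by apply: rpredB; [exact: l2P | exact: xl_sqr Fx].
apply/cvg_ex; exists (L2 lP); apply/cvgrPdist_le => e e0.
have e20 : 0 < e / 2 by rewrite divr_gt0.
have [x Fx] := Fc _ e20.
have xL : `|x - L2 lP| <= e / 2.
  have := @inner_sqr_le (x - L2 lP) _ (key _ _ e20 Fx).
  by rewrite l2_inner_norm ler_pXn2r ?nnegrE // ltW.
apply: filterS Fx => y; rewrite -ball_normE /= => xy.
rewrite -[L2 lP](subrK x) -addrA [e]splitr (le_trans (ler_normD _ _)) //.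
by apply: lerD; [rewrite distrC | exact: ltW].
Qed.

HB.instance Definition _ := Uniform_isComplete.Build l2 l2_complete.
HB.instance Definition _ := CompleteNormedModule_isHilbert.Build R l2
  l2_innerP l2_innerC l2_inner_norm.

End L2.

Section Operators.
Variable R : realType.
Implicit Types H K : hilbertType R.

Definition bounded_operators H : set (H -> H) :=
  [set T | linear T /\ continuous T].
Arguments bounded_operators : clear implicits.

Definition is_adjoint H (S T : H -> H) : Prop := forall x y, '[S x, y] = '[x, T y].

(* The topology on operators induced by the functionals
   T |-> sum_n <T x_n, y_n> with (x_n) and (y_n) square summable. *)
Definition ultraweak K : Type :=
  initial_topology (fun T : K -> K =>
    (fun p : l2 nat K * l2 nat K => usum (fun n => '[T (p.1 n), p.2 n]))
      : {ptws (l2 nat K * l2 nat K) -> R[i]}).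

HB.instance Definition _ K := Topological.on (ultraweak K).

Definition ultraweak_closure K (A : set (K -> K)) : set (K -> K) :=
  bounded_operators K `&` closure (A : set (ultraweak K)).

Record von_neumann_algebra H (M : set (H -> H)) : Prop := {
  vn_bounded : M `<=` bounded_operators H;
  vn_id : M idfun;
  vn_linear : forall (a : R[i]) S T, M S -> M T -> M (a *: S + T);
  vn_comp : forall S T, M S -> M T -> M (S \o T);
  vn_adjoint : forall S T, M S -> is_adjoint S T -> M T;
  vn_closed : ultraweak_closure M `<=` M
}.

Definition span_of K (A : set (K -> K)) : set (K -> K) :=
  [set T | exists n (c : 'I_n -> R[i]) (S : 'I_n -> K -> K),
    (forall i, A (S i)) /\ T = \sum_(i < n) c i *: S i].

(* Positivity of the operator matrix (X i j) on the n-fold sum of K. *)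
Definition positive_matrix K n (X : 'I_n -> 'I_n -> K -> K) : Prop :=
  forall x : 'I_n -> K, 0 <= \sum_(i < n) \sum_(j < n) '[X i j (x j), x i].

(* phi is only constrained on the bounded operators. *)
Record ucp_into K (N : set (K -> K)) (phi : (K -> K) -> (K -> K)) : Prop := {
  ucp_range : forall T, bounded_operators K T -> N (phi T);
  ucp_linear : forall (a : R[i]) S T,
    bounded_operators K S -> bounded_operators K T ->
    phi (a *: S + T) = a *: phi S + phi T;
  ucp_unital : phi idfun = idfun;
  ucp_positive : forall n (X : 'I_n -> 'I_n -> K -> K),
    (forall i j, bounded_operators K (X i j)) ->
    positive_matrix X -> positive_matrix (fun i j => phi (X i j))
}.

(* A completely positive unital projection of B(H) onto M. *)
Definition injective_algebra H (M : set (H -> H)) : Prop :=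
  exists2 E, ucp_into M E & forall T, M T -> E T = T.

Record star_automorphism H (M : set (H -> H))
    (a : (H -> H) -> (H -> H)) : Prop := {
  saut_bij : set_bij M M a;
  saut_linear : forall (c : R[i]) S T, M S -> M T ->
    a (c *: S + T) = c *: a S + a T;
  saut_comp : forall S T, M S -> M T -> a (S \o T) = a S \o a T;
  saut_adjoint : forall S T, M S -> M T -> is_adjoint S T -> is_adjoint (a S) (a T)
}.

Record action_on H (G : groupType) (M : set (H -> H))
    (alpha : G -> (H -> H) -> (H -> H)) : Prop := {
  action_saut : forall g, star_automorphism M (alpha g);
  action_one : forall T, M T -> alpha 1%g T = T;
  action_mul : forall g h T, M T -> alpha (g * h)%g T = alpha g (alpha h T)
}.

End Operators.
Arguments bounded_operators {R} H.

Section CrossedProduct.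
Variables (R : realType) (G : groupType) (H : hilbertType R).
Local Notation C := R[i].
Local Notation l2G := (l2 G (R[i])).
(* H (x) l2(G) is realised as the space l2(G; H) of square summable families,
   with x (x) f = (f(g) x)_g. *)
Local Notation Hl2G := (l2 G H).

Fact delta_subproof (g : G) :
  (fun h : G => (h == g)%:R : C) \in @square_summable R G C.
Proof.
apply/asboolP; exists 1 => A.
have [gA|gA] := boolP (g \in A).
  rewrite (big_fsetD1 g gA) /= eqxx normr1 expr1n big_seq big1 ?addr0 // => h.
  by rewrite !inE => /andP[/negbTE-> _]; rewrite normr0 expr0n.
rewrite big_seq big1 ?ler01 // => h hA; case: eqVneq => [hg|_].
  by rewrite -hg hA in gA.
by rewrite normr0 expr0n.
Qed.
Definition delta (g : G) : l2G := L2 (delta_subproof g).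

Fact tensor_subproof (x : H) (f : l2G) :
  (fun g : G => f g *: x) \in @square_summable R G H.
Proof.
have [M fM] := l2_bounded f; apply/asboolP; exists (M * `|x| ^+ 2) => A.
under eq_bigr do rewrite normrZ exprMn.
by rewrite -mulr_suml ler_wpM2r // exprn_ge0.
Qed.
Definition tensor (x : H) (f : l2G) : Hl2G := L2 (tensor_subproof x f).

(* The operators below are the unique bounded ones with the stated property
   ([get] picks it); for [tensor_op] this is S (x) T. *)
Definition tensor_op (S : H -> H) (T : l2G -> l2G) : Hl2G -> Hl2G :=
  get [set U | bounded_operators _ U /\
    forall x f, U (tensor x f) = tensor (S x) (T f)].

Definition translation (g : G) : l2G -> l2G :=
  get [set T | bounded_operators _ T /\
    forall h, T (delta h) = delta (g * h)%g].

Definition matrix_unit (g h : G) : l2G -> l2G :=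
  get [set T | bounded_operators _ T /\
    forall l, T (delta l) = if l == h then delta g else 0].

Definition Lop (g : G) : Hl2G -> Hl2G := tensor_op idfun (translation g).

(* Psi r = sum_g alpha_(g^-1)(r) (x) e_(g,g), converging strongly. *)
Definition Psi (alpha : G -> (H -> H) -> (H -> H)) (r : H -> H) : Hl2G -> Hl2G :=
  get [set T | bounded_operators _ T /\
    forall x, \sum_(g <- A) tensor_op (alpha (g^-1)%g r) (matrix_unit g g) x
      @[A --> @summability.totally G] --> T x].

Definition crossed_product (M : set (H -> H))
    (alpha : G -> (H -> H) -> (H -> H)) : set (Hl2G -> Hl2G) :=
  ultraweak_closure (span_of
    [set T | exists g r, M r /\ T = Lop g \o Psi alpha r]).

End CrossedProduct.
Arguments Lop {R G} H g.

Section BallFunctions.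
Variables (R : realType) (k : nat).

Definition word_ball (n : nat) : set (free_group k) :=
  [set g | (word_length g <= n)%N].

(* [fset_set] is junk on infinite sets; word balls are finite. *)
Definition chi_ball (n : nat) (t : free_group k) : R :=
  #|` fset_set (word_ball n `&` [set (t * h)%g | h in word_ball n])|%:R /
  #|` fset_set (word_ball n)|%:R.

Definition chi (t : free_group k) : R :=
  let m := (word_length t)./2 in
  if odd (word_length t) then 1 / (k%:R * (2 * k%:R - 1) ^+ m)
  else 1 / (2 * k%:R - 1) ^+ m.

End BallFunctions.

(* Main.v *)
(* The balls around 1 and t in the Cayley tree of the free group meet in a ball
   around the midpoint of [1, t], or, when l(t) is odd, in the union of two balls
   around the ends of the middle edge; counting gives the limit.

   For a finite set F and a conditional expectation E onto M, the map
     x |-> |F|^-1 sum_(g, h in F) L_g Psi(E(x_(g,h))) L_(h^-1)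
   is unital completely positive and multiplies L_g Psi(r) by
   |F /\ gF| / |F|.  Along an ultrafilter finer than the balls these maps
   converge point-weakly, by boundedness also point-ultraweakly, to sigma.
   As chi(1) = 1, sigma fixes Psi(M), so bimodularity follows from Choi's
   multiplicative domain theorem.  Complete positivity of Psi is that of the
   *-automorphisms alpha_g: for a positive matrix Y over M and l > 0, a Neumann
   series inverts Y + l over M, alpha_g transports the inverse, and a selfadjoint
   operator all of whose translates by l > 0 are invertible is positive. *)
Require Import Defs.
From mathcomp Require Import all_boot all_order all_algebra.
From mathcomp Require Import finmap.
From mathcomp Require Import complex.
From mathcomp Require Import all_classical all_reals all_analysis.
From mathcomp.analysis.showcase Require summability.
From mathcomp Require Import ring lra zify.
Set Implicit Arguments.
Unset Strict Implicit.
Unset Printing Implicit Defensive.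
Import Order.TTheory GRing.Theory Num.Theory.
Import numFieldNormedType.Exports.
Local Open Scope classical_set_scope.
Local Open Scope ring_scope.

(** * Balls in free groups *)

(** The averaging map is a composite: compress x to the coordinates in F, which gives a matrix over
    B(H), apply E to its entries, and expand the result back by A |-> |F|^-1 sum L_g Psi(A_(g,h))
    L_h^-1. Free groups are not amenable, so no sequence of finite sets makes all the ratios tend to
    1. Balls still give a limit: with q = 2k - 1 a ball has (k q^n - 1)/(k - 1) elements, hence a
    loss of m in the radius costs a factor q^-m, and replacing the central vertex by an edge brings
    the extra 1/k of the odd case. The positivity of alpha_g on matrices shapes the operator part.
    The usual argument writes a positive matrix as B* B with B over the algebra, by functional
    calculus. Here the relation b (Y + l) = 1 takes its place: read entry by entry it is a finite
    algebraic identity over M, which alpha_g preserves. The passage to the limit needs bounds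
    independent of F; for a unital completely positive map these come from a 2 x 2 block matrix. *)

Section ReducedWords.
Variable k : nat.
Local Notation letter := (letter k).
Implicit Types (u v w y : seq letter) (a c : letter) (P : {pred letter}).

Lemma size_lcons_le a u : (size (lcons a u) <= (size u).+1)%N.
Proof. by case: u => [//|c u] /=; case: ifP => _ /=; lia. Qed.

Lemma size_wmul_le u v : (size (wmul u v) <= size u + size v)%N.
Proof.
elim: u => //= a u IHu; apply: leq_trans (size_lcons_le _ _) _.
by rewrite addSn ltnS.
Qed.

Lemma wmul_cat u v : reduced (u ++ v) -> wmul u v = u ++ v.
Proof.
elim: u => //= a u IHu ruv; rewrite IHu ?(reduced_tail ruv) //.
by move: ruv; case: (u ++ v) => //= c w /andP[/negbTE->].
Qed.

Lemma reduced_cat_cons u a c v : reduced (rcons u a ++ c :: v) =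
  [&& reduced (rcons u a), c != linv a & reduced (c :: v)].
Proof.
rewrite /reduced; case: u => [|b u] //=.
by rewrite cat_path /= last_rcons.
Qed.

Lemma reduced_catl u v : reduced (u ++ v) -> reduced u.
Proof. by rewrite /reduced; case: u => //= a u; rewrite cat_path => /andP[]. Qed.

Lemma reduced_catr u v : reduced (u ++ v) -> reduced v.
Proof. by elim: u => //= a u IHu ruv; apply/IHu/(reduced_tail ruv). Qed.

Lemma size_winv u : size (winv u) = size u.
Proof. by rewrite /winv size_rev size_map. Qed.

Lemma winv_cons a u : winv (a :: u) = rcons (winv u) (linv a).
Proof. by rewrite /winv /= rev_cons. Qed.

(* A word cannot cancel on both sides of a cut of a reduced word. *)
Lemma reduced_cat_or u v y : reduced (u ++ v) -> reduced y ->
  reduced (u ++ y) \/ reduced (winv v ++ y).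
Proof.
case/lastP: u => [|u a]; first by left.
case: v => [|b v] ruv; first by right.
case: y => [|c y] ry; first by left; rewrite cats0 (reduced_catl ruv).
rewrite winv_cons !reduced_cat_cons ry !andbT.
move: ruv; rewrite reduced_cat_cons => /and3P[-> ba /winv_reduced].
rewrite winv_cons => ->; rewrite linvK /=.
case: (eqVneq c (linv a)) => [->|_]; last by left.
by right; rewrite eq_sym.
Qed.

(** P constrains the first letter. This closes the recursion, since after a letter a only [linv a]
    is forbidden. It also covers both shapes to be counted: full balls ([predT]) and the half-balls
    on one side of an edge ([predC1]). *)
Fixpoint words_upto n P : seq (seq letter) :=
  if n is n.+1 then
    [::] :: [seq a :: w | a <- enum P, w <- words_upto n (predC1 (linv a))]
  else [:: [::]].

Lemma mem_words_upto n P w : (w \in words_upto n P) =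
  [&& reduced w, (size w <= n)%N & if w is a :: _ then a \in P else true].
Proof.
elim: n P w => [|n IHn] P [|a w] //=; first by rewrite andbF.
rewrite inE /= ltnS; apply/allpairsPdep/idP => [[b [v [bP vw [-> ->]]]]|].
  move: vw; rewrite IHn mem_enum in bP *; rewrite bP andbT => /and3P[rv -> hv].
  rewrite andbT; case: v rv hv => //= c v rv; rewrite inE => cb.
  by rewrite /reduced /= cb.
move=> /and3P[raw sw aP]; exists a, w; split=> //; first by rewrite mem_enum.
rewrite IHn sw (reduced_tail raw) /=.
by case: w raw {sw} => //= c w /andP[].
Qed.

Lemma uniq_words_upto n P : uniq (words_upto n P).
Proof.
elim: n P => //= n IHn P; apply/andP; split.
  by apply/negP => /allpairsPdep[b [v [_ _]]].
apply: allpairs_uniq_dep; first exact: enum_uniq.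
  by move=> a _; exact: IHn.
by move=> [a v] [b w] _ _ [-> ->].
Qed.

Lemma size_words_upto n P :
  size (words_upto n P) = (1 + #|P| * \sum_(i < n) (2 * k).-1 ^ i)%N.
Proof.
elim: n P => [|n IHn] P /=; first by rewrite big_ord0 muln0.
rewrite size_allpairs_dep -[X in X.+1]/(sumn _).
under eq_map => a do rewrite IHn cardC1 card_prod card_ord card_bool mulnC.
rewrite sumnE big_map big_enum /= sum_nat_const add1n; congr (_ * _).+1.
rewrite [in RHS]big_ord_recl /= expn0 big_distrl /= add1n; congr _.+1.
by apply: eq_bigr => i _; rewrite expnS mulnC [(k * 2)%N]mulnC.
Qed.

End ReducedWords.

(** * Balls of the free group and their intersections *)

Section FreeGroupBalls.
Variable k : nat.
Local Notation fg := (free_group k).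
Implicit Types (g h t : fg).
Local Open Scope group_scope.

Lemma fg_wordM g h : fg_word (g * h) = wmul (fg_word g) (fg_word h).
Proof. by []. Qed.

Lemma fg_wordV g : fg_word g^-1 = winv (fg_word g).
Proof. by []. Qed.

Lemma fg_letterE (x : letter k) : fg_word (fg_letter x) = [:: x].
Proof. by case: x => i []. Qed.

Lemma fg_prod_letters g : g = \prod_(x <- fg_word g) fg_letter x.
Proof.
case: g => s rs; apply/val_inj => /=.
elim: s rs => [|x s IHs] rxs; first by rewrite big_nil.
rewrite big_cons fg_wordM fg_letterE -IHs ?(reduced_tail rxs) //.
by rewrite wmul_cat.
Qed.

(** Cancellation only shortens: a product of n letters has a reduced form of length at most n, and
    the reduced word itself attains the minimum. *)
Lemma word_lengthE g : word_length g = size (fg_word g).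
Proof.
rewrite /word_length; case: ex_minnP => n /existsP[w /eqP gw] min_n.
apply/eqP; rewrite eqn_leq min_n /=; last first.
  by apply/existsP; exists (in_tuple (fg_word g)); apply/eqP/fg_prod_letters.
rewrite gw -[X in (_ <= X)%N](size_tuple w).
elim: (tval w) => [|x s IHs]; first by rewrite big_nil.
rewrite big_cons fg_wordM fg_letterE; apply: leq_trans (size_wmul_le _ _) _.
by rewrite /= add1n ltnS.
Qed.

(** Presents A as the image of a finite list, so that its [fset_set] is meaningful. The base point g
    is free: the words record positions as seen from g. *)
Lemma set_of_words (A : set fg) g (s : seq (seq (letter k))) :
  {in s, forall w, reduced w} ->
  (forall h, A h <-> fg_word (g^-1 * h) \in s) ->
  A = [set` [fset g * insubd (fg_one k) w | w in s]%fset]%classic.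
Proof.
move=> rs As; apply/seteqP; split=> h /=.
  move=> /As hs; apply/imfsetP; exists (fg_word (g^-1 * h)) => //=.
  have -> : g * insubd (fg_one k) (fg_word (g^-1 * h)) = g * (g^-1 * h).
    by congr (g * _); exact: (valKd (fg_one k) (g^-1 * h)).
  by rewrite mulVKg.
move=> /imfsetP[w /= ws ->]; apply/As; rewrite mulKg.
by rewrite -[fg_word _]/(val _) insubdK //; exact: rs.
Qed.

Lemma card_fset_set_words (A : set fg) g (s : seq (seq (letter k))) :
  uniq s -> {in s, forall w, reduced w} ->
  (forall h, A h <-> fg_word (g^-1 * h) \in s) ->
  #|` fset_set A| = size s.
Proof.
move=> us rs As; rewrite (set_of_words rs As) set_fsetK card_in_imfset //=.
  by rewrite undup_id.
move=> v w vs ws /mulgI/(congr1 val).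
by rewrite !insubdK //; [exact: rs ws | exact: rs vs].
Qed.

(** The number of vertices of a tree with n levels in which every vertex has 2k - 1 children. *)
Definition geom n : nat := \sum_(i < n) (2 * k).-1 ^ i.

Lemma geomS n : geom n.+1 = (1 + (2 * k).-1 * geom n)%N.
Proof.
rewrite /geom big_ord_recl expn0 big_distrr /=; congr addn.
by apply: eq_bigr => i _; rewrite expnS.
Qed.

Lemma card_letter : #|{: letter k}| = (2 * k)%N.
Proof. by rewrite card_prod card_ord card_bool mulnC. Qed.

Lemma word_ballE n h :
  @word_ball k n h <-> fg_word (1^-1 * h) \in words_upto n predT.
Proof.
rewrite invg1 mul1g /word_ball /= word_lengthE mem_words_upto.
by rewrite (valP h) /=; case: (fg_word h) => [|a w] //=; rewrite andbT.
Qed.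

Lemma words_upto_reduced n P : {in words_upto n P, forall w : seq (letter k), reduced w}.
Proof. by move=> w; rewrite mem_words_upto => /and3P[]. Qed.

Lemma finite_word_ball n : finite_set (@word_ball k n).
Proof.
by rewrite (set_of_words (@words_upto_reduced n predT) (word_ballE n)).
Qed.

Lemma card_word_ball n :
  #|` fset_set (@word_ball k n)| = (1 + 2 * k * geom n)%N.
Proof.
rewrite (card_fset_set_words (uniq_words_upto n predT)
  (@words_upto_reduced n predT) (word_ballE n)).
by rewrite size_words_upto cardT -cardE card_letter.
Qed.

Definition ball_cap n t :=
  (word_ball n `&` [set (t * h)%g | h in word_ball n])%classic.

Lemma ball_capE n t h : ball_cap n t h <->
  ((size (fg_word h) <= n) && (size (fg_word (t^-1 * h)%g) <= n))%N.
Proof.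
rewrite -!word_lengthE; split=> [[hn [g gn gh]]|/andP[hn thn]].
  by apply/andP; split; rewrite // -gh mulKg.
by split=> //; exists (t^-1 * h); rewrite ?mulVKg.
Qed.

Lemma take_reduced n (w : seq (letter k)) : reduced w -> reduced (take n w).
Proof. by move=> rw; apply: (@reduced_catl _ _ (drop n w)); rewrite cat_take_drop. Qed.

Lemma drop_reduced n (w : seq (letter k)) : reduced w -> reduced (drop n w).
Proof. by move=> rw; apply: (@reduced_catr _ (take n w)); rewrite cat_take_drop. Qed.

(* In the Cayley tree, the intersection of the balls of radius n around 1 and t
   is the ball of radius n - m around the midpoint of [1, t]. *)
Lemma card_ball_cap_even n m t : word_length t = (2 * m)%N -> (m <= n)%N ->
  #|` fset_set (ball_cap n t)| = (1 + 2 * k * geom (n - m))%N.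
Proof.
rewrite word_lengthE => st mn; have rt : reduced (fg_word t) := valP t.
have [u [v [tuv su sv ruv]]] : exists u v : fg, [/\ t = u * v,
    size (fg_word u) = m, size (fg_word v) = m &
    reduced (fg_word u ++ fg_word v)].
  exists (FreeGroup (take_reduced m rt)), (FreeGroup (drop_reduced m rt)).
  rewrite /= cat_take_drop; split=> //.
  - by apply/val_inj; rewrite /= wmul_cat ?cat_take_drop.
  - by rewrite size_take st; case: ltnP; lia.
  - by rewrite size_drop st; lia.
rewrite (@card_fset_set_words _ u (words_upto (n - m) predT)).
- by rewrite size_words_upto cardT -cardE card_letter.
- exact: uniq_words_upto.
- exact: words_upto_reduced.
move=> h; have [y ->] : exists y, h = u * y by exists (u^-1 * h); rewrite mulVKg.
rewrite ball_capE mulKg mem_words_upto (valP y : reduced (fg_word y)).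
rewrite tuv invgM -mulgA mulKg !fg_wordM.
have -> : (if fg_word y is a :: _ then a \in predT else true) = true by case: (fg_word y).
rewrite andbT fg_wordV /=.
have := size_wmul_le (fg_word u) (fg_word y).
have := size_wmul_le (winv (fg_word v)) (fg_word y).
rewrite size_winv su sv.
(* On one side of the midpoint nothing cancels, so one of the two distances is exactly m + |y|,
   while the other is at most that. Both are at most n if and only if |y| <= n - m. *)
case: (reduced_cat_or ruv (valP y : reduced (fg_word y))) => /wmul_cat->;
  by rewrite size_cat ?size_winv ?su ?sv => ? ?; split; lia.
Qed.

(* Here [1, t] has a middle edge and the intersection is the union of two
   balls of radius n - m - 1 centred at its end points. *)
Lemma card_ball_cap_odd n m t : word_length t = (2 * m).+1 -> (m < n)%N ->
  #|` fset_set (ball_cap n t)| = (2 * geom (n - m))%N.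
Proof.
rewrite word_lengthE => st mn; have rt : reduced (fg_word t) := valP t.
have [a [u0 [v0 [tE su sv]]]] : exists a u0 v0,
    [/\ fg_word t = u0 ++ a :: v0, size u0 = m & size v0 = m].
  case E : (drop m (fg_word t)) => [|a v0].
    by move: (congr1 size E); rewrite size_drop st /=; lia.
  exists a, (take m (fg_word t)), v0; rewrite -E cat_take_drop; split=> //.
    by rewrite size_take st; case: ltnP; lia.
  by move: (congr1 size E); rewrite size_drop st /=; lia.
move: (rt); rewrite tE => ruav.
pose u : fg := FreeGroup (reduced_catl ruav).
pose v : fg := FreeGroup (reduced_catr ruav).
have tuv : t = u * v by apply/val_inj; rewrite /= wmul_cat.
pose r := (n - m).-1.
(* Positions seen from u, the near end of the middle edge a: words not starting with a stay on the
   side of u, the others cross the edge and continue from its far end. Each half offers 2k - 1 first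
   letters, so it has [geom r.+1] elements. *)
pose s := words_upto r (predC1 a) ++
  map (cons a) (words_upto r (predC1 (linv a))).
rewrite (@card_fset_set_words _ u s).
- rewrite size_cat size_map !size_words_upto !cardC1 card_letter -/(geom r).
  have -> : (n - m = r.+1)%N by rewrite /r; lia.
  by rewrite geomS; lia.
- rewrite cat_uniq map_inj_uniq ?uniq_words_upto /=; last by move=> x y [].
  rewrite andbT; apply/hasPn => _ /mapP[w _ ->] /=.
  by rewrite mem_words_upto !inE eqxx !andbF.
- move=> w; rewrite mem_cat mem_words_upto => /orP[/and3P[]//|/mapP[y]].
  rewrite mem_words_upto => /and3P[ry _ hy] ->.
  by case: y ry hy => //= c y ry; rewrite inE /reduced /= => ->.
move=> h; have [y ->] : exists y, h = u * y by exists (u^-1 * h); rewrite mulVKg.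
rewrite ball_capE mulKg tuv invgM -mulgA mulKg !fg_wordM fg_wordV.
rewrite mem_cat mem_words_upto (valP y : reduced (fg_word y)) /=.
have := size_wmul_le u0 (fg_word y); rewrite su.
have rva : reduced (winv (a :: v0)).
  exact: winv_reduced (valP v : reduced (fg_word v)).
case E : (fg_word y) (valP y : reduced (fg_word y)) => [|c z] ry.
  rewrite /= !wmulu0 ?(valP v) ?(reduced_catl ruav) // size_winv su /= sv.
  by move=> _; split=> // _; lia.
(* If y starts with a, it does not cancel against u, because u a is reduced, and the distance to 1
   decides. Otherwise y does not cancel against the final [linv a] of [winv (a :: v0)], and the
   distance to t decides. *)
have [ca|ca] := eqVneq c a.
  rewrite ca in ry E *; rewrite wmul_cat ?size_cat; last first.
    have := ruav; have := ry; case/lastP: (u0) => [//|w d].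
    by rewrite !reduced_cat_cons => -> /and3P[-> -> _].
  rewrite winv_cons /wmul foldr_rcons /= -!/(wmul _ _) linvK eqxx => _.
  have := size_wmul_le (winv v0) z; rewrite size_winv sv su => zv.
  rewrite inE /= eqxx andbF /= mem_map; last by move=> x x' [].
  rewrite mem_words_upto (reduced_tail ry) /=.
  have -> : (if z is d :: _ then d \in predC1 (linv a) else true) = true.
    by case: z ry {E zv} => //= d z /andP[].
  by rewrite andbT /r; split; lia.
rewrite (@wmul_cat _ (winv (a :: v0))); last first.
  by move: rva; rewrite winv_cons reduced_cat_cons linvK ca ry !andbT.
rewrite size_cat size_winv /= sv inE /= ca andbT => le_uy.
have -> : (c :: z \in map (cons a) (words_upto r (predC1 (linv a)))) = false.
  by apply/negP => /mapP[x _ [/eqP]]; rewrite (negbTE ca).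
by rewrite orbF /r; split; lia.
Qed.

Lemma geomE (R : realType) n : (0 < k)%N ->
  ((2 * k%:R - 2) * (geom n)%:R : R)%R = ((2 * k%:R - 1) ^+ n - 1)%R.
Proof.
move=> k0; elim: n => [|n IHn]; first by rewrite /geom big_ord0 mulr0 subrr.
have q : ((2 * k).-1%:R = 2 * k%:R - 1 :> R)%R.
  by rewrite -subn1 natrB ?natrM // muln_gt0.
rewrite geomS natrD natrM mulrDr mulrCA IHn exprS q; ring.
Qed.

(** The quotient of the two cardinals, divided through by q^n with q = 2k - 1. In this form n occurs
    only in q^-n, which tends to 0. *)
Lemma chi_ball_even (R : realType) n m t : (1 < k)%N ->
  word_length t = (2 * m)%N -> (m <= n)%N ->
  (chi_ball R n t = (k%:R * (2 * k%:R - 1) ^- m - (2 * k%:R - 1) ^- n) /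
                    (k%:R - (2 * k%:R - 1) ^- n))%R.
Proof.
move=> k1 tm mn; rewrite /chi_ball -/(ball_cap n t) (card_ball_cap_even tm mn).
rewrite card_word_ball; set q : R := (2 * k%:R - 1)%R.
have kR : (2 <= k%:R :> R)%R by rewrite ler_nat.
have q0 : (q != 0)%R by rewrite gt_eqF // /q; lra.
have E j : ((1 + 2 * k * geom j)%:R = (k%:R * q ^+ j - 1) / (k%:R - 1) :> R)%R.
  have := @geomE R j (ltnW k1); rewrite -/q => gE.
  have -> : (k%:R * q ^+ j - 1 = (k%:R - 1) * (1 + 2 * k%:R * (geom j)%:R) :> R)%R.
    have -> : (q ^+ j = 1 + (2 * k%:R - 2) * (geom j)%:R)%R by rewrite gE; ring.
    ring.
  by rewrite natrD !natrM [RHS]mulrAC divff ?mul1r // gt_eqF //; lra.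
have k1R : (k%:R - 1 != 0 :> R)%R by rewrite gt_eqF //; lra.
have qn : (q ^+ n != 0)%R by rewrite expf_neq0.
have q1 j : (1 <= q ^+ j)%R by apply: exprn_ege1; rewrite /q; lra.
have kqn : (k%:R * q ^+ n - 1 != 0)%R.
  by rewrite gt_eqF // subr_gt0; apply: lt_le_trans (ler_pM _ _ kR (q1 n)); lra.
have qm : (q ^+ m != 0)%R by rewrite expf_neq0.
have qnm : (q ^+ (n - m) = q ^+ n / q ^+ m)%R.
  by rewrite -{2}(subnK mn) exprD mulfK.
rewrite !E qnm; field.
by rewrite k1R kqn qn qm.
Qed.

Lemma chi_ball_odd (R : realType) n m t : (1 < k)%N ->
  word_length t = (2 * m).+1 -> (m < n)%N ->
  (chi_ball R n t = ((2 * k%:R - 1) ^- m - (2 * k%:R - 1) ^- n) /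
                    (k%:R - (2 * k%:R - 1) ^- n))%R.
Proof.
move=> k1 tm mn; rewrite /chi_ball -/(ball_cap n t) (card_ball_cap_odd tm mn).
rewrite card_word_ball; set q : R := (2 * k%:R - 1)%R.
have kR : (2 <= k%:R :> R)%R by rewrite ler_nat.
have q0 : (q != 0)%R by rewrite gt_eqF // /q; lra.
have k1R : (k%:R - 1 != 0 :> R)%R by rewrite gt_eqF //; lra.
have E j : ((geom j)%:R = (q ^+ j - 1) / (2 * (k%:R - 1)) :> R)%R.
  rewrite -(@geomE R j (ltnW k1)); field; exact: k1R.
have qn : (q ^+ n != 0)%R by rewrite expf_neq0.
have q1 j : (1 <= q ^+ j)%R by apply: exprn_ege1; rewrite /q; lra.
have kqn : (k%:R * q ^+ n - 1 != 0)%R.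
  by rewrite gt_eqF // subr_gt0; apply: lt_le_trans (ler_pM _ _ kR (q1 n)); lra.
have qm : (q ^+ m != 0)%R by rewrite expf_neq0.
have qnm : (q ^+ (n - m) = q ^+ n / q ^+ m)%R.
  by rewrite -{2}(subnK (ltnW mn)) exprD mulfK.
rewrite natrD !natrM !E qnm; field.
by rewrite k1R kqn qn qm.
Qed.

(** Matches the count used by the averaging maps, h in F with t^-1 h in F, with the intersection of
    F and t F used by [chi_ball]. *)
Lemma card_ball_overlap n t :
  #|` [fset h in fset_set (@word_ball k n) |
        (t^-1 * h)%g \in fset_set (@word_ball k n)]%fset| =
  #|` fset_set (ball_cap n t)|.
Proof.
set X := [fset h in _ | _]%fset; rewrite -(set_fsetK X).
congr #|` fset_set _|; have memB h : (h \in fset_set (@word_ball k n)) =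
    (size (fg_word h) <= n)%N.
  rewrite in_fset_set; last exact: finite_word_ball.
  by apply/idP/idP; rewrite inE /word_ball /= word_lengthE.
apply/seteqP; split=> h /=.
  by rewrite !inE !memB => ?; apply/ball_capE.
by move=> /ball_capE; rewrite !inE !memB.
Qed.

End FreeGroupBalls.

Lemma cvg_chi_ball (R : realType) k (t : free_group k) : (1 < k)%N ->
  (chi_ball R n t @[n --> \oo] --> chi R t).
Proof.
move=> k1; set q : R := (2 * k%:R - 1).
have kR : (2 <= k%:R :> R) by rewrite ler_nat.
have qV : (q ^- n @[n --> \oo] --> (0 : R)).
  under eq_fun do rewrite -exprVn.
  apply: cvg_expr; rewrite ger0_norm ?invr_ge0 ?invf_lt1 /q; lra.
(* Both parities are instances: c = q^-m for odd length, c = k q^-m for even length. *)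
have cvg_quot (c : R) :
    ((c - q ^- n) / (k%:R - q ^- n) @[n --> \oo] --> (c / k%:R)).
  have cst_sub (d : R) : d - q ^- n @[n --> \oo] --> d.
    by rewrite -[d in X in _ --> X]subr0; apply: cvgB qV; exact: cvg_cst.
  by apply: cvgM (cst_sub c) (cvgV _ (cst_sub _)); rewrite gt_eqF //; lra.
rewrite /chi -/q; set l := word_length t.
have lE := odd_double_half l; case: (boolP (odd l)) lE => _ lE.
  have {}lE : word_length t = (2 * l./2).+1 by rewrite -/l -[LHS]lE; lia.
  rewrite div1r invfM mulrC; apply: cvg_trans (cvg_quot (q ^- l./2)).
  apply: near_eq_cvg; near=> n.
  by rewrite (chi_ball_odd R k1 lE) //; near: n; exists (l./2).+1.
have {}lE : word_length t = (2 * l./2)%N by rewrite -/l -[LHS]lE; lia.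
rewrite div1r; have kq : (q ^- l./2 = (k%:R * q ^- l./2) / k%:R).
  by rewrite mulrAC divff ?mul1r // gt_eqF //; lra.
rewrite kq; apply: cvg_trans (cvg_quot (k%:R * q ^- l./2)).
apply: near_eq_cvg; near=> n.
by rewrite (chi_ball_even R k1 lE) //; near: n; exists l./2.
Unshelve. all: by end_near.
Qed.

(** * Hilbert spaces *)

Section UltraLimits.
Variables (R : realType) (T : Type) (U : set_system T).
Context {UU : UltraFilter U}.

(** Compactness of [-c, c] yields a cluster point l. For each e the ultrafilter contains the set
    where f is within e of l or its complement, and the complement would keep l from being a cluster
    point. *)
Lemma ultra_cvg_real (f : T -> R) (c : R) :
  (forall t, `|f t| <= c) -> exists l : R, f t @[t --> U] --> l.
Proof.
move=> fc; have PU : ProperFilter U by exact: ultra_proper.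
have fU : U (f @^-1` [set` `[- c, c]]).
  by apply: filterE => t; rewrite /preimage /mkset in_itv /= -ler_norml.
have [l [_ cl]] := @segment_compact R (- c) c _ (fmap_proper_filter f PU) fU.
exists l; apply/cvgrPdist_lt => e e0.
have [//|Ufar] := in_ultra_setVsetC [set t | `|l - f t| < e] UU.
have [z [zl /=]] := cl (f @` ~` [set t | `|l - f t| < e]) (ball l e)
  (filterS (fun t ft => ex_intro2 _ _ t ft erefl) Ufar) (nbhsx_ballx _ _ e0).
by case: zl => t /= fte <-.
Qed.

Local Notation C := R[i].

Lemma normC_real (r : R) : `|r%:C%C| = `|r|%:C%C.
Proof. by rewrite normc_def /= expr0n addr0 sqrtr_sqr. Qed.

Lemma normCi : `|'i%C : C| = 1.
Proof. by rewrite normc_def /= expr0n expr1n add0r sqrtr1. Qed.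

Lemma normc_ge_Im (x : C) : `|complex.Im x|%:C%C <= `|x|.
Proof.
rewrite -normrN -ReiNIm (le_trans (normc_ge_Re _)) //.
by rewrite normrM normCi mulr1.
Qed.

Lemma ge0_ReC (x : C) : 0 <= x -> (complex.Re x)%:C%C = x.
Proof. by move=> x0; rewrite RRe_real // realE x0. Qed.

Lemma ultra_cvg_complex (f : T -> C) (c : C) :
  (forall t, `|f t| <= c) -> exists l : C, f t @[t --> U] --> l.
Proof.
move=> fc; have PU : ProperFilter U by exact: ultra_proper.
have lec (r : R) : r%:C%C <= c -> r <= complex.Re c.
  by rewrite lecE => /andP[].
have [a fa] := ultra_cvg_real (fun t => lec _ (le_trans (normc_ge_Re _) (fc t))).
have [b fb] := ultra_cvg_real (fun t => lec _ (le_trans (normc_ge_Im _) (fc t))).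
exists (a +i* b)%C; apply/cvgrPdist_lt => e e0.
have [e' e'0 ee'] : exists2 e' : R, 0 < e' & e = (e' + e')%:C%C.
  move: e0; case: e => r s; rewrite ltcE /= => /andP[/eqP-> r0].
  by exists (r / 2); [exact: divr_gt0 | rewrite -splitr].
near=> t.
have at' : `|a - complex.Re (f t)| < e' by near: t; exact: cvgr_dist_lt.
have bt : `|b - complex.Im (f t)| < e' by near: t; exact: cvgr_dist_lt.
rewrite [X in `|X|]complexE (le_lt_trans (ler_normD _ _)) // normrM.
rewrite !normC_real normCi mul1r ee' rmorphD /=.
by apply: ltrD; rewrite ltcR; case: (f t) at' bt.
Unshelve. all: by end_near.
Qed.

End UltraLimits.

Section ComplexLimits.
Variables (R : realType) (T : Type) (F : set_system T).
Context {FF : ProperFilter F}.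
Local Notation C := R[i].

Lemma cvgC_unique (f : T -> C) (a b : C) :
  f t @[t --> F] --> a -> f t @[t --> F] --> b -> a = b.
Proof. by move=> fa fb; apply: (cvg_unique (@norm_hausdorff _ C)) fa fb. Qed.

(** Where f >= 0 it equals |f|, so continuity of the norm gives l = |l|; this yields at once that l
    is real and that it is nonnegative. *)
Lemma cvgC_ge0 (f : T -> C) (l : C) :
  f t @[t --> F] --> l -> (forall t, 0 <= f t) -> 0 <= l.
Proof.
move=> fl f0; have -> : l = `|l|.
  apply: (cvgC_unique fl); apply: cvg_trans (cvg_norm fl).
  by apply: near_eq_cvg; apply: filterE => t; rewrite /= ger0_norm.
exact: normr_ge0.
Qed.

Lemma cvgC_le (f : T -> C) (l c : C) : 0 <= c ->
  f t @[t --> F] --> l -> (forall t, `|f t| <= c) -> `|l| <= c.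
Proof.
move=> c0 fl fc; rewrite -subr_ge0.
apply: (@cvgC_ge0 (fun t => c - `|f t|)); last by move=> t; rewrite subr_ge0.
by apply: cvgB; [exact: cvg_cst | exact: cvg_norm].
Qed.

Lemma cvgC_Z (f : T -> C) (a l : C) :
  f t @[t --> F] --> l -> a * f t @[t --> F] --> a * l.
Proof. by move=> fl; apply: (@cvgM _ _ F _ (fun=> a) f a l) (cvg_cst a) fl. Qed.

Lemma cvgC_P (f g : T -> C) (a l m : C) :
  f t @[t --> F] --> l -> g t @[t --> F] --> m ->
  a * f t + g t @[t --> F] --> a * l + m.
Proof. by move=> fl gm; apply: cvgD gm; exact: cvgC_Z. Qed.

Lemma cvgC_sum (I : Type) (r : seq I) (f : I -> T -> C) (l : I -> C) :
  (forall i, f i t @[t --> F] --> l i) ->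
  \sum_(i <- r) f i t @[t --> F] --> \sum_(i <- r) l i.
Proof.
move=> fl; elim: r => [|i r IHr].
  have -> : (fun t => \sum_(i <- [::]) f i t) = fun=> 0 :> C.
    by apply/funext => t; rewrite big_nil.
  by rewrite big_nil; apply: (@cvg_cst C 0 T F).
have -> : (fun t => \sum_(j <- i :: r) f j t) =
          (fun t => f i t + \sum_(j <- r) f j t).
  by apply/funext => t; rewrite big_cons.
by rewrite big_cons; apply: (@cvgD _ _ _ F _ (f i) _ _ _ (fl i) IHr).
Qed.

Lemma cvgC_of_bound (f : T -> C) (l : C) :
  (forall e : C, 0 < e -> \forall t \near F, `|l - f t| <= e) ->
  f t @[t --> F] --> l.
Proof. by move=> h; apply/cvgrPdist_le. Qed.

End ComplexLimits.

Section HilbertBasics.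
Variables (R : realType) (H : hilbertType R).
Local Notation C := R[i].
Implicit Types (x y z : H) (a : C).

Lemma innerNl x z : '[- x, z] = - '[x, z].
Proof. by rewrite -scaleN1r innerZl mulN1r. Qed.

Lemma innerNr x z : '[x, - z] = - '[x, z].
Proof. by rewrite innerC innerNl rmorphN /= -innerC. Qed.

Lemma innerBl x y z : '[x - y, z] = '[x, z] - '[y, z].
Proof. by rewrite innerDl innerNl. Qed.

Lemma innerBr x y z : '[x, y - z] = '[x, y] - '[x, z].
Proof. by rewrite innerDr innerNr. Qed.

Lemma inner0r x : '[x, 0] = 0.
Proof. by rewrite innerC inner0l rmorph0. Qed.

Lemma inner_suml (I : Type) (r : seq I) (f : I -> H) z :
  '[\sum_(i <- r) f i, z] = \sum_(i <- r) '[f i, z].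
Proof. by apply: (big_morph (fun x => '[x, z])) => [x y|]; rewrite ?innerDl ?inner0l. Qed.

Lemma inner_sumr (I : Type) (r : seq I) (f : I -> H) z :
  '[z, \sum_(i <- r) f i] = \sum_(i <- r) '[z, f i].
Proof. by apply: (big_morph (fun x => '[z, x])) => [x y|]; rewrite ?innerDr ?inner0r. Qed.

Lemma inner_ge0 x : 0 <= '[x, x].
Proof. by rewrite inner_norm exprn_ge0. Qed.

Lemma inner_eq0 x : '[x, x] = 0 -> x = 0.
Proof. by rewrite inner_norm => /eqP; rewrite sqrf_eq0 normr_eq0 => /eqP. Qed.

Lemma inner_le x y : `|'[x, y]| <= `|x| * `|y|.
Proof.
rewrite -(@ler_pXn2r _ 2) ?nnegrE ?mulr_ge0 // exprMn -(inner_norm x) -(inner_norm y).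
exact: (inner_CauchySchwarz (@innerP R H) (@innerC R H) inner_ge0 inner_eq0).
Qed.

Lemma inner_ext x y : (forall z, '[x, z] = '[y, z]) -> x = y.
Proof.
move=> xy; apply/eqP; rewrite -subr_eq0; apply/eqP/inner_eq0.
by rewrite innerBl xy subrr.
Qed.

Lemma norm_le_inner x (c : C) : 0 <= c ->
  (forall y, `|'[x, y]| <= c * `|y|) -> `|x| <= c.
Proof.
move=> c0 /(_ x); rewrite inner_norm normrX normr_id expr2.
have [->|x0] := eqVneq x 0; first by rewrite normr0.
by rewrite ler_pM2r // normr_gt0.
Qed.

Lemma cvg_innerl (T : Type) (F : set_system T) (FF : Filter F) (f : T -> H) x z :
  f t @[t --> F] --> x -> '[f t, z] @[t --> F] --> '[x, z].
Proof.
move=> /cvgrPdist_lt fx; apply/cvgrPdist_le => e e0.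
have z0 : 0 < `|z| + 1 by rewrite ltr_wpDl.
apply: filterS (fx _ (divr_gt0 e0 z0)) => t xt.
rewrite -innerBl (le_trans (inner_le _ _)) //.
rewrite (le_trans (ler_wpM2r _ (ltW xt))) // -mulrA ler_piMr ?(ltW e0) //.
by rewrite mulrC ler_pdivrMr // mul1r lerDl.
Qed.

End HilbertBasics.

(** * Riesz representation by approximate minimisation *)

Section Riesz.
Variables (R : realType) (H : hilbertType R).
Local Notation C := R[i].
Variables (f : H -> C) (c : C).
Hypothesis fP : forall a x y, f (a *: x + y) = a * f x + f y.
Hypothesis fc : forall x, `|f x| <= c * `|x|.
Hypothesis c0 : 0 <= c.

(** If z represents f, then J x = |x - z|^2 - |z|^2, so the approximate minimisers of J are the
    vectors close to z. *)
Let J (x : H) : C := `|x| ^+ 2 - (f x + (f x)^*).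

Let J_real x : (complex.Re (J x))%:C%C = J x.
Proof.
rewrite RRe_real //; apply: realB; first by rewrite realE exprn_ge0.
by rewrite CrealE rmorphD /= conjCK addrC.
Qed.

Let J_ge x : - c ^+ 2 <= J x.
Proof.
have fx : f x + (f x)^* <= 2 * (c * `|x|).
  apply: le_trans (real_ler_norm _) _.
    by rewrite CrealE rmorphD /= conjCK addrC.
  by rewrite (le_trans (ler_normD _ _)) // norm_conjC mulr2n mulrDl mul1r lerD.
rewrite -subr_ge0.
have -> : J x - - c ^+ 2 = (`|x| - c) ^+ 2 + (2 * (c * `|x|) - (f x + (f x)^*)).
  by rewrite /J; ring.
apply: addr_ge0; last by rewrite subr_ge0.
by rewrite real_exprn_even_ge0 // realB // ?normr_real // ger0_real.
Qed.

Let riesz_approx (e : C) : 0 < e ->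
  exists x, forall y, `|f y - '[y, x]| <= e * `|y|.
Proof.
move=> e0; pose S := [set complex.Re (J x) | x in [set: H]].
have infS : has_inf S.
  split; first by exists (complex.Re (J 0)); exists 0.
  exists (complex.Re (- c ^+ 2)) => _ [x _ <-].
  by have := J_ge x; rewrite lecE => /andP[].
have er : 0 < complex.Re (e ^+ 2).
  by rewrite -ltcR ge0_ReC ?exprn_gt0 // ltW // exprn_gt0.
have [_ [x _ <-] xS] := inf_adherent er infS.
have Jx z : J x <= J z + e ^+ 2.
  rewrite -J_real -(J_real z) -[e ^+ 2]ge0_ReC ?exprn_ge0 ?(ltW e0) //.
  rewrite -rmorphD lecR; apply/ltW/(lt_le_trans xS); rewrite lerD2r.
  by apply: inf_lbound; [case: infS | exists z].
exists x => y; have [y0|y0] := eqVneq y 0.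
  have := fP 1 0 0; rewrite scale1r addr0 mul1r -[LHS]addr0 => /addrI f0.
  by rewrite y0 -f0 inner0l subrr !normr0 mulr0.
have n0 : 0 < `|y| ^+ 2 by rewrite exprn_gt0 // normr_gt0.
have [d dE] : exists d, d = f y - '[y, x] by eexists.
(* This a minimises J along the line x + a y. The decrease obtained there is |d|^2 / |y|^2, which
   cannot exceed e^2 since x is within e^2 of the infimum. *)
have [a aE] : exists a, a = d^* / `|y| ^+ 2 by eexists.
rewrite -dE.
rewrite -(@ler_pXn2r _ 2) ?nnegrE ?mulr_ge0 ?(ltW e0) //.
have := Jx (a *: y + x).
have nJ : (`|y| ^+ 2)^* = `|y| ^+ 2 :> C by apply/CrealP; rewrite realE ltW.
have -> : J (a *: y + x) = J x - `|d| ^+ 2 / `|y| ^+ 2.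
  have aC : a^* = d / `|y| ^+ 2 by rewrite aE rmorphM fmorphV /= nJ conjCK.
  have fy : f y = d + '[y, x] by rewrite dE subrK.
  rewrite /J -(inner_norm (_ + _)) -(inner_norm x) !(innerDl, innerDr, innerZl, innerZr).
  rewrite fP fy !(rmorphD, rmorphM) /= -!innerC aC (inner_norm y) aE normCK.
  field.
  by rewrite normr_eq0.
by rewrite -addrA lerDl addrC subr_ge0 ler_pdivrMr // exprMn.
Qed.

(* The approximate representers form a Cauchy filter. *)
Lemma riesz : exists z, forall x, f x = '[x, z].
Proof.
pose B (e : C) : set H := [set x | forall y, `|f y - '[y, x]| <= e * `|y|].
pose F := filter_from [set e : C | 0 < e] B.
have FF : ProperFilter F.
  apply: filter_from_proper; last by move=> e /= /riesz_approx[x]; exists x.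
  apply: filter_from_filter; first by exists 1; exact: ltr01.
  move=> e e' /= e0 e'0.
  have [m m0 [me me']] : exists2 m : C, 0 < m & m <= e /\ m <= e'.
    (* A lower bound of e and e' given by a formula, in place of a minimum in the partial order of
       [C]. *)
    exists (e * e' / (e + e')); first by rewrite divr_gt0 ?mulr_gt0 ?addr_gt0.
    have := mulr_ge0 (ltW e0) (ltW e0); have := mulr_ge0 (ltW e'0) (ltW e'0).
    by split; rewrite ler_pdivrMr ?addr_gt0 // mulrDr ?lerDr // mulrC lerDl.
  exists m; first exact: m0.
  by move=> x Bx; split=> y; apply: le_trans (Bx y) _; exact: ler_wpM2r.
have /cvg_ex[z Fz] : cvg F.
  apply: (@cauchy_cvg H); apply: cauchy_exP => e e0.
  have e3 : 0 < e / 3 by rewrite divr_gt0.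
  have [x Bx] := riesz_approx e3; exists x, (e / 3) => // x' Bx'.
  rewrite -ball_normE /=; apply: (@le_lt_trans _ _ (e / 3 + e / 3)).
    apply: norm_le_inner => [|y]; first by rewrite addr_ge0 // ltW.
    rewrite innerC norm_conjC innerBr mulrDl.
    have -> : '[y, x] - '[y, x'] = (f y - '[y, x']) - (f y - '[y, x]) by ring.
    by rewrite (le_trans (ler_normB _ _)) // lerD.
  by rewrite -subr_gt0; have -> : e - (e / 3 + e / 3) = e / 3 by field.
exists z => y; rewrite innerC; apply: (canRL conjCK).
apply: (@cvgC_unique _ _ F _ (fun x => '[x, y])); last exact: cvg_innerl.
apply: cvgC_of_bound => e e0.
have y0 : 0 < `|y| + 1 by rewrite ltr_wpDl.
exists (e / (`|y| + 1)); first exact: divr_gt0.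
move=> x Bx; rewrite [X in _ - X]innerC -rmorphB norm_conjC.
apply: le_trans (Bx y) _; rewrite mulrAC ler_pdivrMr // mulrDr mulr1 lerDl.
exact: ltW.
Qed.

End Riesz.

(** * Bounded operators and adjoints *)

Section BoundedOperators.
Variables (R : realType) (H : hilbertType R).
Local Notation C := R[i].
Implicit Types (S T : H -> H) (x y z : H) (a c : C).

Section LinearFun.
Variables (T : H -> H) (linT : linear T).

Lemma opP a x y : T (a *: x + y) = a *: T x + T y.
Proof. exact: linT. Qed.

Lemma opD x y : T (x + y) = T x + T y.
Proof. by have := opP 1 x y; rewrite !scale1r. Qed.

Lemma op0 : T 0 = 0.
Proof. by apply: (addIr (T 0)); rewrite -opD !add0r. Qed.

Lemma opZ a x : T (a *: x) = a *: T x.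
Proof. by have := opP a x 0; rewrite op0 !addr0. Qed.

Lemma opB x y : T (x - y) = T x - T y.
Proof. by rewrite -scaleN1r opD opZ scaleN1r. Qed.

Lemma op_sum (I : Type) (r : seq I) (f : I -> H) :
  T (\sum_(i <- r) f i) = \sum_(i <- r) T (f i).
Proof. by apply: (big_morph T) => [x y|]; rewrite ?opD ?op0. Qed.

End LinearFun.

Lemma bounded_opI T c : linear T -> (forall x, `|T x| <= c * `|x|) ->
  bounded_operators H T.
Proof.
move=> linT Tc; split=> // x; apply/cvgrPdist_le => e e0.
pose d := `|c| + 1; have d0 : 0 < d by rewrite ltr_wpDl.
near=> y; rewrite -(opB linT) (le_trans (Tc _)) //.
have xy : `|x - y| < e / d.
  near: y; have := @cvg_id _ (nbhs x); move/cvgrPdist_lt; apply; exact: divr_gt0.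
apply: (@le_trans _ _ (d * `|x - y|)).
  (* The constant c is an arbitrary complex number; the bound at a nonzero vector forces it to be
     real. *)
  have c0 : c \is Num.real \/ x - y = 0.
    have [->|xy0] := eqVneq (x - y) 0; [by right|left].
    have := Tc (x - y); move/(le_trans (normr_ge0 _))=> h.
    by rewrite realE -(pmulr_lge0 _ (_ : 0 < `|x - y|)) ?normr_gt0 // h.
  case: c0 => [cr|->]; last by rewrite normr0 !mulr0.
  by rewrite ler_wpM2r // (le_trans (real_ler_norm cr)) // lerDl.
by rewrite mulrC -ler_pdivlMr // ltW.
Unshelve. all: by end_near.
Qed.

Lemma bounded_opE T : bounded_operators H T ->
  exists2 c : C, 0 < c & forall x, `|T x| <= c * `|x|.
Proof.
move=> [linT /(_ 0)/cvgrPdist_lt/(_ 1 ltr01)].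
rewrite (op0 linT) => /nbhs_ballP[d /= d0 dT].
(* Rescaled to norm d / 2, a vector has an image of norm less than 1. *)
exists (2 / d) => [|x]; first exact: divr_gt0.
have [->|x0] := eqVneq x 0; first by rewrite (op0 linT) !normr0 mulr0.
have nx : 0 < `|x| by rewrite normr_gt0.
have [r rE] : exists r, r = d / (2 * `|x|) by eexists.
have r0 : 0 < r by rewrite rE divr_gt0 ?mulr_gt0.
have {}dT y : `|y| < d -> `|T y| < 1.
  by move=> yd; have := dT y; rewrite -!ball_normE /= !sub0r !normrN; exact.
have := dT (r *: x); rewrite (opZ linT) !normrZ (gtr0_norm r0).
have -> : r * `|x| = d / 2.
  by rewrite rE invfM mulrA -mulrA mulVf ?mulr1 // gt_eqF.
rewrite ltr_pdivrMr // ltr_pMr // ltr1n => /(_ isT)/ltW.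
rewrite mulrC -ler_pdivlMr // mul1r rE invf_div => /le_trans; apply.
by rewrite mulrAC.
Qed.

Lemma bounded_op_lin T : bounded_operators H T -> linear T.
Proof. by case. Qed.

Lemma bounded_op_id : bounded_operators H idfun.
Proof. by apply: (@bounded_opI _ 1) => [a x y //|x]; rewrite mul1r. Qed.

Lemma bounded_opP a S T : bounded_operators H S -> bounded_operators H T ->
  bounded_operators H (a *: S + T).
Proof.
move=> bS bT; have [c c0 Sc] := bounded_opE bS; have [d d0 Td] := bounded_opE bT.
apply: (@bounded_opI _ (`|a| * c + d)) => [b x y|x].
  rewrite !fctE (opP (bounded_op_lin bS)) (opP (bounded_op_lin bT)).
  rewrite !scalerDr !scalerA [b * a]mulrC -!addrA; congr (_ + _).
  by rewrite addrCA.
rewrite !fctE (le_trans (ler_normD _ _)) // normrZ mulrDl lerD // -mulrA.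
exact: ler_wpM2l.
Qed.

Lemma bounded_op_comp S T : bounded_operators H S -> bounded_operators H T ->
  bounded_operators H (S \o T).
Proof.
move=> bS bT; have [c c0 Sc] := bounded_opE bS; have [d d0 Td] := bounded_opE bT.
apply: (@bounded_opI _ (c * d)) => [b x y|x] /=.
  by rewrite (opP (bounded_op_lin bT)) (opP (bounded_op_lin bS)).
by rewrite (le_trans (Sc _)) // -mulrA ler_wpM2l // ltW.
Qed.

Lemma bounded_op0 : bounded_operators H 0.
Proof.
have zE x : (0 : H -> H) x = 0 by [].
by apply: (@bounded_opI _ 0) => [b x y|x];
  rewrite !zE ?scaler0 ?addr0 // normr0 mul0r.
Qed.

Lemma bounded_opZ a T : bounded_operators H T -> bounded_operators H (a *: T).
Proof. by move=> bT; rewrite -[_ *: _]addr0; apply: bounded_opP bounded_op0. Qed.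

Lemma bounded_opD S T : bounded_operators H S -> bounded_operators H T ->
  bounded_operators H (S + T).
Proof. by move=> bS bT; rewrite -[S]scale1r; exact: bounded_opP. Qed.

Lemma bounded_op_sum (I : Type) (r : seq I) (f : I -> H -> H) :
  (forall i, bounded_operators H (f i)) ->
  bounded_operators H (\sum_(i <- r) f i).
Proof.
move=> bf; elim/big_ind : _ => // [|S T]; [exact: bounded_op0|exact: bounded_opD].
Qed.

(** Riesz representation of y |-> conj (B x y) for each x. Adjoints and weak limits of operators are
    both obtained from their forms in this way. *)
Lemma sesquilinear_op (B : H -> H -> C) (c : C) : 0 <= c ->
  (forall a x y z, B (a *: x + y) z = a * B x z + B y z) ->
  (forall a x y z, B x (a *: y + z) = a^* * B x y + B x z) ->
  (forall x y, `|B x y| <= c * `|x| * `|y|) ->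
  exists T, [/\ bounded_operators H T, forall x, `|T x| <= c * `|x| &
    forall x y, '[T x, y] = B x y].
Proof.
move=> c0 BPl BPr Bc.
have /choice[T TB] x : exists z, forall y, (B x y)^* = '[y, z].
  apply: (@riesz _ _ (fun y => (B x y)^*) (c * `|x|)) => [a y z|y|].
  - by rewrite BPr rmorphD rmorphM /= conjCK.
  - by rewrite norm_conjC.
  - by rewrite mulr_ge0.
have {}TB x y : '[T x, y] = B x y by rewrite innerC -TB conjCK.
have Tc x : `|T x| <= c * `|x|.
  by apply: norm_le_inner => [|y]; rewrite ?mulr_ge0 // TB.
exists T; split=> //; apply: bounded_opI Tc => a x y.
by apply: inner_ext => z; rewrite innerP !TB.
Qed.

Lemma adjoint_ex T : bounded_operators H T ->
  exists2 S, bounded_operators H S & is_adjoint T S.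
Proof.
move=> bT; have [c c0 Tc] := bounded_opE bT; have linT := bounded_op_lin bT.
have [||||S [bS _ TS]] := @sesquilinear_op (fun x y => '[x, T y]) c.
- exact: ltW.
- by move=> a x y z; rewrite innerP.
- by move=> a x y z; rewrite (opP linT) innerDr innerZr.
- move=> x y; rewrite (le_trans (inner_le _ _)) //.
  by rewrite mulrAC mulrC ler_wpM2r.
by exists S => // x y; rewrite innerC -TS -innerC.
Qed.

Lemma adjoint_sym S T : is_adjoint S T -> is_adjoint T S.
Proof. by move=> ST x y; rewrite innerC -ST -innerC. Qed.

Lemma adjoint_bounded S T :
  bounded_operators H S -> is_adjoint S T -> bounded_operators H T.
Proof.
move=> /adjoint_ex[T' bT' ST'] ST; rewrite (_ : T = T') //; apply/funext => x.
by apply: inner_ext => z; rewrite innerC -ST ST' -innerC.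
Qed.

Lemma adjoint_unique S T T' : is_adjoint S T -> is_adjoint S T' -> T = T'.
Proof.
move=> ST ST'; apply/funext => x.
by apply: inner_ext => z; rewrite innerC -ST ST' -innerC.
Qed.

Lemma adjoint_comp S S' T T' :
  is_adjoint S S' -> is_adjoint T T' -> is_adjoint (S \o T) (T' \o S').
Proof. by move=> SS TT x y /=; rewrite SS TT. Qed.

(** With a = <S y, x> and b = <T x, y>, reality of a + b says that the imaginary parts are opposite.
    Replacing y by i y makes i (a - b) real, so the real parts agree. Together, a = conj b. *)
Lemma form_real_adjoint S T : linear S -> linear T ->
  (forall x y, '[S y, x] + '[T x, y] \is Num.real) -> is_adjoint S T.
Proof.
move=> linS linT real_ST y x; rewrite (innerC y).
set a := '[S y, x]; set b := '[T x, y].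
have /CrealP : a + b \is Num.real by exact: real_ST.
have /CrealP : 'i * a - 'i * b \is Num.real.
  have := real_ST x ('i *: y).
  by rewrite (opZ linS) innerZl innerZr conjCi mulNr.
rewrite !(rmorphB, rmorphD, rmorphM) /= conjCi !mulNr opprK => e2 e1.
have i0 : 'i != 0 :> C by exact: neq0Ci.
have e3 : b^* - a^* = a - b.
  by apply: (mulfI i0); rewrite !mulrBr addrC -e2; ring.
have : 2 * b^* = 2 * a.
  have -> : 2 * b^* = (a^* + b^*) + (b^* - a^*) by ring.
  by rewrite e1 e3; ring.
by move/(mulfI (_ : 2 != 0 :> C)) => ->; rewrite // pnatr_eq0.
Qed.

End BoundedOperators.

Section WeakLimits.
Variables (R : realType) (H : hilbertType R) (I : Type) (U : set_system I).
Context {UU : UltraFilter U}.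
Local Notation C := R[i].

(** Weak compactness of balls of operators: every coefficient <S_t x, y> is bounded, hence converges
    along U, and the limits form a bounded sesquilinear form. *)
Lemma weak_ultralimit (S : I -> H -> H) (c : C) : 0 <= c ->
  (forall t, linear (S t)) -> (forall t x, `|S t x| <= c * `|x|) ->
  exists T, [/\ bounded_operators H T, forall x, `|T x| <= c * `|x| &
    forall x y, '[S t x, y] @[t --> U] --> '[T x, y]].
Proof.
move=> c0 linS Sc; have PU : ProperFilter U by exact: ultra_proper.
have Sxy x y t : `|'[S t x, y]| <= c * `|x| * `|y|.
  by rewrite (le_trans (inner_le _ _)) // ler_wpM2r.
have /choice[B SB] (p : H * H) : exists l : C, '[S t p.1, p.2] @[t --> U] --> l.
  exact: (ultra_cvg_complex (Sxy p.1 p.2)).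
have [|||T [bT Tc TB]] := @sesquilinear_op _ _ (fun x y => B (x, y)) c c0.
- move=> a x y z; apply: (cvgC_unique (SB (a *: x + y, z))).
  under eq_fun do rewrite (opP (linS _)) innerP.
  exact: cvgC_P (SB (x, z)) (SB (y, z)).
- move=> a x y z; apply: (cvgC_unique (SB (x, a *: y + z))).
  under eq_fun do rewrite /= innerDr innerZr.
  exact: cvgC_P (SB (x, y)) (SB (x, z)).
- move=> x y; apply: cvgC_le (SB (x, y)) (Sxy x y).
  by rewrite !mulr_ge0.
- exists T; split=> // x y; rewrite TB; exact: (SB (x, y)).
Qed.

End WeakLimits.

#[local] Existing Instance summability.totally_filter.

(** * Square summable families and their truncations *)

Section L2Theory.
Variables (R : realType) (I : choiceType) (H : hilbertType R).
Local Notation C := R[i].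
Local Notation l2 := (l2 I H).
Implicit Types (x y z : l2) (v w : H) (i j : I) (A : {fset I}).

Lemma l2_ext x y : (forall i, x i = y i) -> x = y.
Proof. by move=> xy; apply/val_inj/funext. Qed.

Lemma l2_innerE x y : '[x, y] = usum (fun i => '[x i, y i]).
Proof. by []. Qed.

Lemma l2_cvg_inner x y :
  \sum_(i <- A) '[x i, y i] @[A --> @summability.totally I] --> '[x, y].
Proof. exact/usum_cvg/l2_ucvg. Qed.

Lemma l2_sumE (J : Type) (r : seq J) (f : J -> l2) i :
  (\sum_(j <- r) f j) i = \sum_(j <- r) f j i.
Proof. by apply: (big_morph (fun x : l2 => x i)). Qed.

Lemma l2_norm_sqrE x : `|x| ^+ 2 = usum (fun i => `|x i| ^+ 2 : C).
Proof.
by rewrite -inner_norm l2_innerE; congr usum; apply/funext => i; rewrite inner_norm.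
Qed.

Lemma l2_sum_le x A : \sum_(i <- A) `|x i| ^+ 2 <= `|x| ^+ 2.
Proof.
have [M xM] := l2_bounded x; rewrite l2_norm_sqrE.
by have [_] := ge0_usum (fun i => exprn_ge0 2 (normr_ge0 (x i))) xM.
Qed.

Lemma l2_norm_le x (c : C) : 0 <= c ->
  (forall A, \sum_(i <- A) `|x i| ^+ 2 <= c ^+ 2) -> `|x| <= c.
Proof.
move=> c0 xc; rewrite -(@ler_pXn2r _ 2) ?nnegrE // l2_norm_sqrE.
by have [_ _] := ge0_usum (fun i => exprn_ge0 2 (normr_ge0 (x i))) xc.
Qed.

Lemma l2_exists (f : I -> H) (c : C) :
  (forall A, \sum_(i <- A) `|f i| ^+ 2 <= c) -> exists x : l2, forall i, x i = f i.
Proof.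
move=> fc; have fP : f \in @square_summable R I H by apply/asboolP; exists c.
by exists (L2 fP).
Qed.

Fact single_subproof j v :
  (fun i : I => if i == j then v else 0) \in @square_summable R I H.
Proof.
apply/asboolP; exists (`|v| ^+ 2) => A.
have [jA|jA] := boolP (j \in A).
  rewrite (big_fsetD1 j jA) /= eqxx big_seq big1 ?addr0 // => i.
  by rewrite !inE => /andP[/negbTE-> _]; rewrite normr0 expr0n.
rewrite big_seq big1 ?exprn_ge0 // => i iA; case: eqVneq => [ij|_].
  by rewrite -ij iA in jA.
by rewrite normr0 expr0n.
Qed.
Definition single j v : l2 := L2 (single_subproof j v).

Lemma singleE j v i : single j v i = if i == j then v else 0.
Proof. by []. Qed.

Lemma singleP (a : C) j v w : single j (a *: v + w) = a *: single j v + single j w.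
Proof.
apply: l2_ext => i.
have -> : (a *: single j v + single j w) i = a *: single j v i + single j w i.
  by [].
by rewrite !singleE; case: eqP => _ //; rewrite scaler0 addr0.
Qed.

Lemma inner_single x j v : '[x, single j v] = '[x j, v].
Proof.
rewrite l2_innerE; apply: (usum_unique _).2.
apply: cvg_near_cst; exists [fset j]%fset => // A /= /fsubsetP jA.
have {}jA : j \in A by apply: jA; rewrite inE.
rewrite (big_fsetD1 j jA) /= eqxx big_seq big1 ?addr0 // => i.
by rewrite !inE => /andP[/negbTE-> _]; rewrite inner0r.
Qed.

Lemma inner_singlel x j v : '[single j v, x] = '[v, x j].
Proof. by rewrite innerC inner_single -innerC. Qed.

Lemma norm_single j v : `|single j v| = `|v|.
Proof.
apply/eqP; rewrite -(@eqrXn2 _ 2) // -!inner_norm inner_single singleE eqxx.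
exact/eqP.
Qed.

Definition trunc A x : l2 := \sum_(i <- A) single i (x i).

Lemma trunc_dist A x :
  `|x - trunc A x| ^+ 2 = `|x| ^+ 2 - \sum_(i <- A) `|x i| ^+ 2.
Proof.
rewrite -(inner_norm (_ - _)) innerBl !innerBr (inner_norm x) /trunc.
rewrite !inner_sumr inner_suml.
have -> : \sum_(i <- A) '[x, single i (x i)] = \sum_(i <- A) `|x i| ^+ 2.
  by apply: eq_bigr => i _; rewrite inner_single inner_norm.
have -> : \sum_(i <- A) '[single i (x i), x] = \sum_(i <- A) `|x i| ^+ 2.
  by apply: eq_bigr => i _; rewrite inner_singlel inner_norm.
have -> : \sum_(i <- A) '[\sum_(j <- A) single j (x j), single i (x i)] =
          \sum_(i <- A) `|x i| ^+ 2.
  rewrite big_seq [RHS]big_seq; apply: eq_bigr => i iA.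
  rewrite inner_single l2_sumE (big_fsetD1 i iA) /= eqxx big_seq big1.
    by rewrite addr0 inner_norm.
  by move=> j; rewrite !inE eq_sym => /andP[/negbTE-> _].
by rewrite subrr subr0.
Qed.

Lemma trunc_near x (e : C) : 0 < e ->
  \forall A \near @summability.totally I, `|x - trunc A x| < e.
Proof.
move=> e0; have := @l2_cvg_inner x x; rewrite inner_norm => /cvgrPdist_lt.
move=> /(_ _ (exprn_gt0 2 e0)) h; near=> A.
have : `| `|x| ^+ 2 - \sum_(i <- A) '[x i, x i]| < e ^+ 2 by near: A.
under eq_bigr do rewrite inner_norm.
rewrite -trunc_dist ger0_norm ?exprn_ge0 // ltr_pXn2r // nnegrE //.
exact: ltW.
Unshelve. all: by end_near.
Qed.

Lemma cvg_trunc x : trunc A x @[A --> @summability.totally I] --> x.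
Proof. by apply/cvgrPdist_lt => e /(trunc_near x). Qed.

(* Passing to adjoints, whose coordinates are determined by the values on
   [single]s, avoids a density argument. *)
Lemma op_ext_single (S T : l2 -> l2) :
  bounded_operators _ S -> bounded_operators _ T ->
  (forall j v, S (single j v) = T (single j v)) -> S = T.
Proof.
move=> /adjoint_ex[S' _ SS] /adjoint_ex[T' _ TT] ST.
apply/funext => x; apply: inner_ext => y; rewrite SS TT; congr '[_, _].
apply: l2_ext => i; apply: inner_ext => v.
by rewrite innerC -inner_singlel -SS ST TT inner_singlel -innerC.
Qed.

Lemma diag_op (S : I -> H -> H) (c : C) : 0 <= c -> (forall i, linear (S i)) ->
  (forall i v, `|S i v| <= c * `|v|) ->
  exists D : l2 -> l2, [/\ bounded_operators _ D, forall x, `|D x| <= c * `|x| &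
    forall x i, D x i = S i (x i)].
Proof.
move=> c0 linS Sc.
have sumS x A : \sum_(i <- A) `|S i (x i)| ^+ 2 <= (c * `|x|) ^+ 2.
  apply: (@le_trans _ _ (\sum_(i <- A) c ^+ 2 * `|x i| ^+ 2)).
    by apply: ler_sum => i _; rewrite -exprMn ler_pXn2r ?nnegrE ?mulr_ge0.
  by rewrite -mulr_sumr exprMn ler_wpM2l ?exprn_ge0 // l2_sum_le.
have /choice[D DE] x : exists y : l2, forall i, y i = S i (x i).
  exact: l2_exists (sumS x).
have Dc x : `|D x| <= c * `|x|.
  apply: l2_norm_le => [|A]; first by rewrite mulr_ge0.
  by under eq_bigr do rewrite DE; exact: sumS.
exists D; split=> //; apply: bounded_opI Dc => a x y; apply: l2_ext => i.
have -> : (a *: D x + D y) i = a *: D x i + D y i by [].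
by rewrite !DE -(opP (linS i)).
Qed.

(** On a norm-bounded family weak convergence implies ultraweak convergence: the tail beyond A is at
    most c |y| |x - trunc A x|, uniformly in t, and the finite part converges term by term. *)
Lemma inner_diag_cvg (J : Type) (U : set_system J) (PU : ProperFilter U)
    (S : J -> H -> H) (T : H -> H) (c : C) x y : 0 <= c ->
  (forall t, linear (S t)) -> (forall t v, `|S t v| <= c * `|v|) ->
  linear T -> (forall v, `|T v| <= c * `|v|) ->
  (forall v w, '[S t v, w] @[t --> U] --> '[T v, w]) ->
  usum (fun i => '[S t (x i), y i]) @[t --> U] --> usum (fun i => '[T (x i), y i]).
Proof.
move=> c0 linS Sc linT Tc ST.
have tail (P : H -> H) (A : {fset I}) : linear P -> (forall v, `|P v| <= c * `|v|) ->
    `|usum (fun i => '[P (x i), y i]) - \sum_(i <- A) '[P (x i), y i]| <=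
    c * `|y| * `|x - trunc A x|.
  move=> linP Pc; have [D [bD Dc DE]] := @diag_op (fun=> P) c c0 (fun=> linP) (fun=> Pc).
  have -> : usum (fun i => '[P (x i), y i]) = '[D x, y].
    by rewrite l2_innerE; congr usum; apply/funext => i; rewrite DE.
  have -> : \sum_(i <- A) '[P (x i), y i] = '[D (trunc A x), y].
    rewrite (op_sum (bounded_op_lin bD)) inner_suml; apply: eq_bigr => i _.
    rewrite -inner_singlel; congr '[_, _]; apply: l2_ext => j.
    rewrite DE !singleE; case: eqP => // _; exact/esym/op0.
  rewrite -innerBl -(opB (bounded_op_lin bD)) (le_trans (inner_le _ _)) //.
  by rewrite mulrAC ler_wpM2r.
apply: cvgC_of_bound => e e0; have e3 : 0 < e / 3 by rewrite divr_gt0.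
pose d := c * `|y| + 1.
have d0 : 0 < d by rewrite ltr_wpDl // mulr_ge0.
have [A xA] := filter_ex (trunc_near x (divr_gt0 e3 d0)).
have tailA P : linear P -> (forall v, `|P v| <= c * `|v|) ->
    `|usum (fun i => '[P (x i), y i]) - \sum_(i <- A) '[P (x i), y i]| <= e / 3.
  move=> linP /(tail P A linP) h; apply: le_trans h _.
  apply: (@le_trans _ _ (d * `|x - trunc A x|)); first by rewrite ler_wpM2r // lerDl.
  by rewrite mulrC -ler_pdivlMr // ltW.
have : \sum_(i <- A) '[S t (x i), y i] @[t --> U] --> \sum_(i <- A) '[T (x i), y i].
  by apply: cvgC_sum => i; exact: ST.
move=> /cvgrPdist_lt/(_ _ e3); apply: filterS => t dt.
have := tailA _ linT Tc; have := tailA _ (linS t) (Sc t); move: dt.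
set b := usum _; set a := usum _; set p := \sum_(i <- A) _; set q := \sum_(i <- A) _.
move=> pq bq ap.
have -> : a - b = (a - p) + (p - q) - (b - q) by ring.
have e3E : e = e / 3 + e / 3 + e / 3 by field.
rewrite [leRHS]e3E (le_trans (ler_normB _ _)) // lerD //.
by rewrite (le_trans (ler_normD _ _)) // lerD // ltW.
Qed.

End L2Theory.

Section UltraweakClosure.
Variables (R : realType) (K : hilbertType R) (I : Type) (U : set_system I).
Context {PU : ProperFilter U}.

(** The ultraweak topology is initial for a map into a product of copies of C, so convergence of
    each single functional is enough for S_t to enter every neighbourhood of T. *)
Lemma ultraweak_closure_lim (A : set (K -> K)) (S : I -> K -> K) (T : K -> K)
    (c : R[i]) : 0 <= c ->
  (forall t, A (S t)) -> (forall t, linear (S t)) ->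
  (forall t v, `|S t v| <= c * `|v|) ->
  linear T -> (forall v, `|T v| <= c * `|v|) ->
  (forall v w, '[S t v, w] @[t --> U] --> '[T v, w]) ->
  ultraweak_closure A T.
Proof.
move=> c0 AS linS Sc linT Tc ST; split; first exact: bounded_opI Tc.
pose ev (P : K -> K) : {ptws (l2 nat K * l2 nat K) -> R[i]} :=
  fun p => usum (fun n => '[P (p.1 n), p.2 n]).
have evS : {ptws, ev (S t) @[t --> U] --> ev T}.
  apply/pointwise_cvgP => p.
  exact: (@inner_diag_cvg _ _ _ _ _ PU _ _ _ p.1 p.2 c0).
move=> B /= [_ [[V oV <-] VT VB]].
have UV : U (fun t => V (ev (S t))) by apply: evS; exact: open_nbhs_nbhs.
have [t Vt] := filter_ex UV.
by exists (S t); split; [exact: AS | exact: VB].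
Qed.

End UltraweakClosure.

(** * Completely positive maps *)

Lemma ge0_addr_conj (R : realType) (a b : R[i]) :
  `|a| <= b -> 0 <= 2 * b + (a + a^*).
Proof.
move=> ab; rewrite -[X in _ + X]opprK subr_ge0.
apply: le_trans (real_ler_norm _) _.
  by rewrite realN CrealE rmorphD /= conjCK addrC.
rewrite normrN (le_trans (ler_normD _ _)) // norm_conjC.
by rewrite mulr2n mulrDl mul1r lerD.
Qed.

Section UcpMaps.
Variables (R : realType) (K : hilbertType R) (N : set (K -> K)).
Variable phi : (K -> K) -> (K -> K).
Hypothesis ucp : ucp_into N phi.
Hypothesis vnb : N `<=` bounded_operators K.
Local Notation C := R[i].
Local Notation bounded := (bounded_operators K).
Implicit Types (S T : K -> K) (x y : K).

Lemma sum_enum_val (I : finType) (V : nmodType) (F : I -> V) :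
  \sum_i F i = \sum_(i < #|I|) F (enum_val i).
Proof. by rewrite -(big_enum_val F). Qed.

(** Reindexing along [enum_val]; matrices can then be indexed by [bool] for 2 x 2 blocks, or by
    pairs for matrices of matrices. *)
Lemma ucp_positive_fin (I : finType) (X : I -> I -> K -> K) :
  (forall i j, bounded (X i j)) ->
  (forall x : I -> K, 0 <= \sum_i \sum_j '[X i j (x j), x i]) ->
  forall x : I -> K, 0 <= \sum_i \sum_j '[phi (X i j) (x j), x i].
Proof.
move=> bX X0 x; pose X' (i j : 'I_#|I|) := X (enum_val i) (enum_val j).
have posX' : positive_matrix X'.
  move=> y; have := X0 (y \o enum_rank).
  congr (0 <= _); rewrite sum_enum_val; apply: eq_bigr => i _.
  by rewrite sum_enum_val; apply: eq_bigr => j _; rewrite /= !enum_valK.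
have := ucp_positive ucp (fun i j => bX _ _) posX' (x \o enum_val).
congr (0 <= _); rewrite [RHS]sum_enum_val; apply: eq_bigr => i _.
by rewrite [RHS]sum_enum_val.
Qed.

Lemma ucp_scalar (c : C) : phi (c *: idfun) = c *: idfun.
Proof.
have id0 := bounded_op_id K; have z0 := bounded_op0 K.
have phi0 : phi 0 = 0.
  have := ucp_linear ucp 1 z0 z0; rewrite !scale1r addr0.
  by move/eqP; rewrite -subr_eq0 opprD addrA subrr sub0r oppr_eq0 => /eqP.
by have := ucp_linear ucp c id0 z0; rewrite phi0 !addr0 (ucp_unital ucp).
Qed.

(** Applies phi to the 2 x 2 matrix with c on the diagonal and S and its adjoint T off it, which is
    positive because |S| <= c. *)
Lemma ucp_block S T (c : C) : 0 <= c -> bounded S -> is_adjoint S T ->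
  (forall x, `|S x| <= c * `|x|) -> forall x y,
  0 <= c * '[x, x] + c * '[y, y] + ('[phi S y, x] + '[phi T x, y]).
Proof.
move=> c0 bS ST Sc x y; have bT := adjoint_bounded bS ST.
pose X (i j : bool) := if i then if j then c *: idfun else S
                       else if j then T else c *: idfun : K -> K.
have bc : bounded (c *: idfun) by exact/bounded_opZ/bounded_op_id.
have := @ucp_positive_fin _ X _ _ (fun b => if b then x else y).
rewrite !big_bool /= !ucp_scalar !fctE !innerZl.
have -> : c * '[x, x] + c * '[y, y] + ('[phi S y, x] + '[phi T x, y]) =
  c * '[x, x] + '[phi S y, x] + ('[phi T x, y] + c * '[y, y]) by ring.
apply=> [[] []//|z].
rewrite !big_bool /= !fctE !innerZl.
move: (z true) (z false) => {}x {}y.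
have -> : c * '[x, x] + '[S y, x] + ('[T x, y] + c * '[y, y]) =
  c * (`|x| - `|y|) ^+ 2 + (2 * (c * `|x| * `|y|) + ('[S y, x] + '[T x, y])).
  by rewrite !inner_norm; ring.
apply: addr_ge0.
  by rewrite mulr_ge0 // real_exprn_even_ge0 // realB ?normr_real.
rewrite (adjoint_sym ST) [X in '[S y, x] + X]innerC; apply: ge0_addr_conj.
by rewrite (le_trans (inner_le _ _)) // mulrAC ler_wpM2r.
Qed.

(** Nonnegative numbers are real, so [ucp_block] shows that <phi S y, x> + <phi T x, y> is real for
    all x and y. *)
Lemma ucp_adjoint S T : bounded S -> is_adjoint S T -> is_adjoint (phi S) (phi T).
Proof.
move=> bS ST; have bT := adjoint_bounded bS ST.
have [c c0 Sc] := bounded_opE bS.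
have [linS _] := vnb (ucp_range ucp bS).
have [linT _] := vnb (ucp_range ucp bT).
apply: form_real_adjoint => // x y.
have := ucp_block (ltW c0) bS ST Sc x y; move/ger0_real => h.
have -> : '[phi S y, x] + '[phi T x, y] =
  (c * '[x, x] + c * '[y, y] + ('[phi S y, x] + '[phi T x, y])) -
  (c * '[x, x] + c * '[y, y]) by ring.
apply: realB h _; apply: ger0_real.
have cx z : 0 <= c * '[z, z] by rewrite mulr_ge0 ?inner_ge0 ?(ltW c0).
by rewrite addr_ge0.
Qed.

Lemma ucp_norm S (c : C) : 0 < c -> bounded S -> (forall x, `|S x| <= c * `|x|) ->
  forall x, `|phi S x| <= c * `|x|.
Proof.
move=> c0 bS Sc y; have [T bT ST] := adjoint_ex bS.
(* For fixed y this first vector minimises the block form. *)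
have := ucp_block (ltW c0) bS ST Sc (- c^-1 *: phi S y) y.
rewrite (ucp_adjoint bT (adjoint_sym ST)) !(innerZl, innerZr) !inner_norm.
have cR : (- c^-1)^* = - c^-1.
  by apply/CrealP; rewrite realN realV ger0_real // ltW.
rewrite cR; set n := `|phi S y|; set m := `|y|.
have -> : c * (- c^-1 * (- c^-1 * n ^+ 2)) + c * m ^+ 2 +
  (- c^-1 * n ^+ 2 + - c^-1 * n ^+ 2) = (c ^+ 2 * m ^+ 2 - n ^+ 2) / c.
  by field; rewrite gt_eqF.
have m0 : 0 <= m by exact: normr_ge0.
have n0 : 0 <= n by exact: normr_ge0.
have cm0 : 0 <= c * m by exact: mulr_ge0 (ltW c0) m0.
by rewrite pmulr_lge0 ?invr_gt0 // subr_ge0 -exprMn ler_pXn2r ?nnegrE.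
Qed.

Lemma ucp_gram (I : finType) (a b : I -> K -> K) :
  (forall i, bounded (a i)) -> (forall i, is_adjoint (a i) (b i)) ->
  forall x : I -> K, 0 <= \sum_i \sum_j '[phi (b i \o a j) (x j), x i].
Proof.
move=> ba ab; apply: ucp_positive_fin => [i j|x].
  by apply: bounded_op_comp (ba j); exact: adjoint_bounded (ab i).
have -> : \sum_i \sum_j '[b i (a j (x j)), x i] =
    '[\sum_j a j (x j), \sum_i a i (x i)].
  rewrite inner_sumr; apply: eq_bigr => i _.
  by rewrite inner_suml; apply: eq_bigr => j _; rewrite (adjoint_sym (ab i)).
exact: inner_ge0.
Qed.

(** For small t the linear part dominates. The choice t = - conj a / (d + 1) is small enough and
    also covers d = 0; it gives -|a|^2 (d + 2) / (d + 1)^2 >= 0. *)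
Lemma quadratic_ge0_eq0 (a d : C) : 0 <= d ->
  (forall t : C, 0 <= t * a + (t * a)^* + t * t^* * d) -> a = 0.
Proof.
move=> d0 /(_ (- a^* / (d + 1))); have d1 : 0 < d + 1 by rewrite ltr_wpDl.
have dR : (d + 1)^* = d + 1 by apply/CrealP; rewrite ger0_real // ltW.
rewrite !(rmorphM, rmorphN, fmorphV) /= conjCK dR.
have -> : - a^* / (d + 1) * a + - a / (d + 1) * a^* +
  - a^* / (d + 1) * (- a / (d + 1)) * d =
  - ((a * a^*) * ((d + 2) / (d + 1) ^+ 2)).
  by field; rewrite gt_eqF.
rewrite -normCK oppr_ge0 pmulr_lle0; last first.
  by rewrite divr_gt0 ?exprn_gt0 // ltr_wpDl.
move=> a0; apply/eqP; rewrite -normr_eq0 -sqrf_eq0 eq_le a0.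
by rewrite exprn_ge0.
Qed.

(* Choi's multiplicative domain: the 3 x 3 Gram matrix of (1, S*, X) is tested
   on vectors (- S* x, x, t y). *)
Lemma ucp_mull S T X : bounded S -> is_adjoint S T -> phi S = S -> phi T = T ->
  phi (S \o T) = S \o T -> bounded X -> phi (S \o X) = S \o phi X.
Proof.
move=> bS ST fS fT fST bX; have bT := adjoint_bounded bS ST.
have [Y bY XY] := adjoint_ex bX.
pose a (i : 'I_3) := match val i with 0 => idfun | 1 => T | _ => X end : K -> K.
pose b (i : 'I_3) := match val i with 0 => idfun | 1 => S | _ => Y end : K -> K.
have ba i : bounded (a i).
  by case: i => [[|[|i]] ?]; rewrite /a //=; exact: bounded_op_id.
have ab i : is_adjoint (a i) (b i).
  by case: i => [[|[|i]] ?]; rewrite /a /b //=; exact: adjoint_sym.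
have gram := ucp_gram ba ab.
pose v x0 x1 x2 (i : 'I_3) : K := match val i with 0 => x0 | 1 => x1 | _ => x2 end.
have {}gram x0 x1 x2 := gram (v x0 x1 x2).
apply/funext => y; apply: inner_ext => x; apply/eqP.
rewrite -subr_eq0; apply/eqP.
pose d := '[phi (Y \o X) y, y].
have d0 : 0 <= d.
  have := @ucp_gram 'I_1 _ _ (fun=> bX) (fun=> XY) (fun=> y).
  by rewrite !big_ord1.
apply: (quadratic_ge0_eq0 d0) => t.
have fX := ucp_adjoint bX XY.
have fSX : is_adjoint (phi (S \o X)) (phi (Y \o T)).
  by apply: ucp_adjoint (adjoint_comp ST XY); exact: bounded_op_comp.
have linfX := bounded_op_lin (vnb (ucp_range ucp bX)).
have linfSX := bounded_op_lin (vnb (ucp_range ucp (bounded_op_comp bS bX))).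
(* As phi fixes S, T and their product, the part of the form free of t is |T x|^2 - |T x|^2 - |T
   x|^2 + |T x|^2 = 0. What remains is linear in t with coefficient <phi(S X) y - S phi(X) y, x>,
   plus |t|^2 d. *)
have := gram (- T x) x (t *: y).
rewrite !big_ord_recl !big_ord0 /v /a /b /= !addr0.
rewrite -![phi (idfun \o _)]/(phi _) -![phi (_ \o idfun)]/(phi _).
rewrite (ucp_unital ucp) fT fS fST (opZ linfX) (opZ linfSX).
rewrite !(innerZl, innerZr, innerNr) (adjoint_sym fX) (adjoint_sym fSX).
have linS := bounded_op_lin bS.
have linYX := bounded_op_lin (vnb (ucp_range ucp
  (bounded_op_comp (adjoint_bounded bX XY) bX))).
rewrite -[idfun (- T x)]/(- T x) -[(S \o T) x]/(S (T x)).
rewrite -[- T x]scaleN1r (opZ linS) !innerZl (opZ linYX) innerZl -/d.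
rewrite ST -ST (innerC (T x)) -ST (innerC x).
rewrite !(rmorphM, rmorphB) /=.
by congr (0 <= _); ring.
Qed.

(** Obtained from [ucp_mull], applied to T and the adjoint of X, by taking adjoints. *)
Lemma ucp_mulr S T X : bounded S -> is_adjoint S T -> phi S = S -> phi T = T ->
  phi (T \o S) = T \o S -> bounded X -> phi (X \o S) = phi X \o S.
Proof.
move=> bS ST fS fT fTS bX; have bT := adjoint_bounded bS ST.
have [Y bY XY] := adjoint_ex bX.
have := ucp_mull bT (adjoint_sym ST) fT fS fTS bY => TY.
have := ucp_adjoint (bounded_op_comp bX bS) (adjoint_comp XY ST).
rewrite TY => /adjoint_sym/adjoint_unique; apply.
apply: adjoint_comp; first exact: adjoint_sym.
exact/adjoint_sym/ucp_adjoint.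
Qed.

End UcpMaps.

Section UcpLimits.
Variables (R : realType) (K : hilbertType R) (A : set (K -> K)).
Variables (I : Type) (U : set_system I).
Context {UU : UltraFilter U}.
Hypothesis bA : A `<=` bounded_operators K.
Variable phi : I -> (K -> K) -> (K -> K).
Hypothesis ucp : forall t, ucp_into A (phi t).
Local Notation bounded := (bounded_operators K).

(** By [ucp_norm] the operators phi_t T share one bound for each T, so they converge weakly along U
    and the limit lies in the ultraweak closure. The remaining properties pass to the limit through
    coefficients. *)
Lemma ucp_ultralimit : exists sigma, ucp_into (ultraweak_closure A) sigma /\
  forall T, bounded T -> forall x y,
    '[phi t T x, y] @[t --> U] --> '[sigma T x, y].
Proof.
have PU : ProperFilter U by exact: ultra_proper.
have /choice[sigma sP] (T : K -> K) : exists S, bounded T ->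
    ultraweak_closure A S /\
    forall x y, '[phi t T x, y] @[t --> U] --> '[S x, y].
  (* [ucp_into] says nothing about unbounded T; [idfun] is a placeholder there. *)
  have [bT|nbT] := pselect (bounded T); last by exists idfun.
  have [c c0 Tc] := bounded_opE bT.
  have lin t := bounded_op_lin (bA (ucp_range (ucp t) bT)).
  have phic t := ucp_norm (ucp t) bA c0 bT Tc.
  have [S [bS Sc TS]] := weak_ultralimit (ltW c0) lin phic.
  exists S => _; split=> //.
  apply: (ultraweak_closure_lim (ltW c0) _ lin phic (bounded_op_lin bS) Sc TS).
  by move=> t; apply: (ucp_range (ucp t)).
exists sigma; split; last by move=> T /sP[].
have slim T (bT : bounded T) := (sP T bT).2.
split.
- by move=> T /sP[].
- move=> a S T bS bT; apply/funext => x; apply: inner_ext => y.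
  apply: (cvgC_unique (slim _ (bounded_opP a bS bT) x y)).
  have -> : (fun t => '[phi t (a *: S + T) x, y]) =
      (fun t => a * '[phi t S x, y] + '[phi t T x, y]).
    by apply/funext => t; rewrite (ucp_linear (ucp t)) // -innerP.
  rewrite [X in _ --> X](innerP a); exact: cvgC_P (slim S bS x y) (slim T bT x y).
- apply/funext => x; apply: inner_ext => y.
  apply: (cvgC_unique (slim _ (bounded_op_id K) x y)).
  have -> : (fun t => '[phi t idfun x, y]) = fun=> '[x, y].
    by apply/funext => t; rewrite (ucp_unital (ucp t)).
  exact: cvg_cst.
- move=> n X bX posX x.
  apply: (@cvgC_ge0 _ _ U _
    (fun t => \sum_(i < n) \sum_(j < n) '[phi t (X i j) (x j), x i])).
    apply: cvgC_sum => i; apply: cvgC_sum => j.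
    exact: (slim _ (bX i j)).
  by move=> t; exact: (ucp_positive (ucp t) bX posX x).
Qed.

End UcpLimits.

(** * Positivity and star automorphisms *)

Section PositiveOperators.
Variables (R : realType) (K : hilbertType R).
Local Notation C := R[i].
Local Notation bounded := (bounded_operators K).
Implicit Types (A B : K -> K) (x y : K).

(** The closure property that a Neumann series calls for: weak limits of bounded sequences along
    ultrafilters. It passes from an algebra to the matrices over it entry by entry. *)
Definition weakly_closed (N : set (K -> K)) := forall (U : set_system nat),
  UltraFilter U -> forall (S : nat -> K -> K) (T : K -> K) (c : C), 0 <= c ->
  (forall t, N (S t)) -> (forall t, linear (S t)) ->
  (forall t v, `|S t v| <= c * `|v|) ->
  bounded T -> (forall v, `|T v| <= c * `|v|) ->
  (forall v w, '[S t v, w] @[t --> U] --> '[T v, w]) -> N T.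

Lemma geometricC_cvg0 (q : C) : 0 <= q -> q < 1 ->
  forall e : C, 0 < e -> \forall n \near \oo, q ^+ n < e.
Proof.
move=> q0 q1 e e0.
have qE := ge0_ReC q0; set r := complex.Re q in qE.
have r0 : 0 <= r by rewrite -lecR qE.
have r1 : `|r| < 1 by rewrite ger0_norm // -ltcR qE.
have er : 0 < complex.Re e by rewrite -ltcR ge0_ReC // ltW.
have /cvgrPdist_lt/(_ _ er) := cvg_expr r1.
apply: filterS => n; rewrite sub0r normrN ger0_norm ?exprn_ge0 // => rn.
by rewrite -qE -(ge0_ReC (ltW e0)) -rmorphXn ltcR.
Qed.

Lemma geom_sum_le (q : C) n : 0 <= q -> q < 1 ->
  \sum_(i < n) q ^+ i <= (1 - q)^-1.
Proof.
move=> q0 q1; have d0 : 0 < 1 - q by rewrite subr_gt0.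
rewrite -[leRHS]mul1r ler_pdivlMr // mulrC -opprB mulNr -subrX1 opprB.
by rewrite lerBlDr lerDl exprn_ge0.
Qed.

(* b is a weak limit of partial sums of the Neumann series of (1 - d)^-1. *)
Lemma left_inverse_sub (N : set (K -> K)) (d : K -> K) (q : C) :
  N `<=` bounded -> N 0 -> N idfun ->
  (forall a S T, N S -> N T -> N (a *: S + T)) ->
  (forall S T, N S -> N T -> N (S \o T)) -> weakly_closed N ->
  N d -> 0 <= q -> q < 1 -> (forall x, `|d x| <= q * `|x|) ->
  exists2 b, N b & forall x, b (x - d x) = x.
Proof.
move=> bN N0 N1 NP Ncomp Nweak Nd q0 q1 dq.
have [lind _] := bN _ Nd.
have Npow n : N (iter n d).
  by elim: n => [|n IHn]; [exact: N1 | exact: Ncomp Nd IHn].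
have powq n x : `|iter n d x| <= q ^+ n * `|x|.
  elim: n => [|n IHn]; first by rewrite expr0 mul1r.
  by rewrite iterS (le_trans (dq _)) // exprS -mulrA ler_wpM2l.
pose S n : K -> K := \sum_(i < n) iter i d.
have SE n x : S n x = \sum_(i < n) iter i d x by rewrite /S fct_sumE.
have NS n : N (S n).
  elim: n => [|n IHn]; first by rewrite /S big_ord0.
  by rewrite /S big_ord_recr /= -[X in X + _]scale1r; exact: NP.
have Sc n x : `|S n x| <= (1 - q)^-1 * `|x|.
  rewrite SE (le_trans (ler_norm_sum _ _ _)) //.
  apply: (@le_trans _ _ (\sum_(i < n) q ^+ i * `|x|)); first exact: ler_sum.
  by rewrite -mulr_suml ler_wpM2r // geom_sum_le.
have linS n := bounded_op_lin (bN _ (NS n)).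
have c0 : 0 <= (1 - q)^-1 by rewrite invr_ge0 subr_ge0 ltW.
have [U [UU Uoo]] := ultraFilterLemma (@eventually_filter).
have [b [bb bc Sb]] := @weak_ultralimit R K nat U UU S _ c0 linS Sc.
exists b; first exact: (Nweak U UU S b _ c0 NS linS Sc bb bc Sb).
have PU : ProperFilter U by exact: ultra_proper.
move=> x; apply: inner_ext => y; apply: (cvgC_unique (Sb _ _)).
apply: cvgC_of_bound => e e0; apply: Uoo.
pose c := `|x| * `|y| + 1; have cp : 0 < c by rewrite ltr_wpDl // mulr_ge0.
have := geometricC_cvg0 q0 q1 (divr_gt0 e0 cp); apply: filterS => n qn.
have -> : S n (x - d x) = x - iter n d x.
  elim: n {qn} => [|n IHn]; first by rewrite SE big_ord0 subrr.
  rewrite SE big_ord_recr /= -SE IHn.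
  have [linn _] := bN _ (Npow n).
  by rewrite (opB linn) -iterSr addrA subrK.
rewrite -innerBl opprB addrC subrK (le_trans (inner_le _ _)) //.
apply: (@le_trans _ _ (q ^+ n * c)).
  rewrite (le_trans (ler_wpM2r _ (powq n x))) // -mulrA ler_wpM2l ?exprn_ge0 //.
  by rewrite lerDl.
by rewrite -ler_pdivlMr // ltW.
Qed.

(* For s = l / m^2 one has |1 - s (A + l)|^2 <= 1 - l^2 / m^2. *)
Lemma left_inverse_positive (N : set (K -> K)) A (l : C) :
  N `<=` bounded -> N 0 -> N idfun ->
  (forall a S T, N S -> N T -> N (a *: S + T)) ->
  (forall S T, N S -> N T -> N (S \o T)) -> weakly_closed N ->
  N A -> (forall x, 0 <= '[A x, x]) -> 0 < l ->
  exists2 b, N b & forall x, b (A x + l *: x) = x.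
Proof.
move=> bN N0 N1 NP Ncomp Nweak NA A0 l0.
have [c c0 Ac] := bounded_opE (bN _ NA).
pose m := c + l; have m0 : 0 < m by exact: addr_gt0.
pose s := l / m ^+ 2; have s0 : 0 < s by rewrite divr_gt0 // exprn_gt0.
have sR : s^* = s by apply/CrealP; rewrite ger0_real // ltW.
pose d : K -> K := (- s) *: A + (1 - s * l) *: idfun.
have dE x : d x = x - s *: (A x + l *: x).
  have -> : d x = (- s) *: A x + (1 - s * l) *: x by [].
  by rewrite scalerBl scale1r scalerDr scalerA scaleNr opprD addrCA.
have Nd : N d by apply: (NP) => //; rewrite -[_ *: idfun]addr0; exact: (NP).
pose q2 := 1 - l ^+ 2 / m ^+ 2.
have lm : l ^+ 2 / m ^+ 2 <= 1.
  rewrite ler_pdivrMr ?exprn_gt0 // mul1r ler_pXn2r ?nnegrE ?(ltW l0) ?(ltW m0) //.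
  by rewrite lerDr ltW.
have q20 : 0 <= q2 by rewrite subr_ge0.
have q21 : q2 < 1 by rewrite ltrBlDr ltrDl divr_gt0 // exprn_gt0.
have dq x : `|d x| <= sqrtC q2 * `|x|.
  rewrite -(@ler_pXn2r _ 2) ?nnegrE ?mulr_ge0 ?sqrtC_ge0 // exprMn sqrtCK.
  set w := A x + l *: x.
  have wx : l * `|x| ^+ 2 <= '[w, x].
    by rewrite innerDl innerZl inner_norm lerDr.
  have xw : '[x, w] = '[w, x].
    rewrite innerC; apply/CrealP; rewrite ger0_real //; apply: le_trans wx.
    by rewrite mulr_ge0 ?exprn_ge0 // ltW.
  have wm : `|w| ^+ 2 <= m ^+ 2 * `|x| ^+ 2.
    rewrite -exprMn ler_pXn2r ?nnegrE ?mulr_ge0 ?(ltW m0) //.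
    rewrite (le_trans (ler_normD _ _)) // mulrDl normrZ gtr0_norm // lerD //.
  rewrite -(inner_norm (d x)) dE -/w innerBl !innerBr !innerZl !innerZr sR xw.
  rewrite !inner_norm -subr_ge0.
  (* With s = l / m^2 the difference splits into two terms, whose signs are given by [wx] and
     [wm]. *)
  have -> : q2 * `|x| ^+ 2 - (`|x| ^+ 2 - s * '[w, x] -
      (s * '[w, x] - s * (s * `|w| ^+ 2))) =
    2 * s * ('[w, x] - l * `|x| ^+ 2) + s ^+ 2 * (m ^+ 2 * `|x| ^+ 2 - `|w| ^+ 2).
    by rewrite /q2 /s; field; rewrite gt_eqF.
  have s00 := ltW s0; have s20 : 0 <= 2 * s by rewrite mulr_ge0.
  apply: addr_ge0; apply: mulr_ge0 => //; rewrite ?subr_ge0 ?exprn_ge0 //.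
have q1 : sqrtC q2 < 1.
  by rewrite -(@ltr_pXn2r _ 2) ?nnegrE ?sqrtC_ge0 // sqrtCK expr1n.
have sq0 : 0 <= sqrtC q2 by rewrite sqrtC_ge0.
have [b Nb bd] := left_inverse_sub bN N0 N1 NP Ncomp Nweak Nd sq0 q1 dq.
exists (s *: b + 0); first exact: NP.
move=> x; rewrite addr0.
have -> : (s *: b) (A x + l *: x) = b (s *: (A x + l *: x)).
  by rewrite (opZ (bounded_op_lin (bN _ Nb))).
by rewrite -[RHS]bd dE subKr.
Qed.

Lemma positive_selfadjoint A : linear A -> (forall x, 0 <= '[A x, x]) ->
  is_adjoint A A.
Proof.
move=> linA A0; apply: form_real_adjoint => // x y.
have -> : '[A y, x] + '[A x, y] = '[A (x + y), x + y] - '[A x, x] - '[A y, y].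
  by rewrite (opD linA) innerDl !innerDr; ring.
by rewrite !realB // ger0_real.
Qed.

(* At the least r >= 0 with A + r >= 0, the operator A + r is bounded below by
   left invertibility, which contradicts minimality unless r = 0. *)
Lemma positive_of_left_inverses A : bounded A -> is_adjoint A A ->
  (forall l : C, 0 < l -> exists2 b, bounded b & forall x, b (A x + l *: x) = x) ->
  forall x, 0 <= '[A x, x].
Proof.
move=> bA AA Ainv; have linA := bounded_op_lin bA.
have [c c0 Ac] := bounded_opE bA.
pose f x : R := complex.Re '[A x, x]; pose n x : R := complex.Re (`|x| ^+ 2).
have fE x : (f x)%:C%C = '[A x, x].
  by rewrite RRe_real //; apply/CrealP; rewrite -innerC AA.
have nE x : (n x)%:C%C = `|x| ^+ 2 by rewrite ge0_ReC // exprn_ge0.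
have n0 x : 0 <= n x by rewrite -lecR nE exprn_ge0.
pose S : set R := [set r | 0 <= r /\ forall x, 0 <= f x + r * n x].
have infS : has_inf S.
  split; last by exists 0 => r [].
  exists (complex.Re c); split; first by rewrite -lecR ge0_ReC // ltW.
  move=> x; rewrite -lecR rmorphD rmorphM /= fE nE ge0_ReC ?(ltW c0) //.
  rewrite -[X in X + _]opprK addrC subr_ge0 (le_trans (real_ler_norm _)) //.
    by rewrite realN -fE; apply/CrealP; rewrite fE -innerC AA.
  by rewrite normrN (le_trans (inner_le _ _)) // expr2 mulrA ler_wpM2r.
set r0 := inf S.
have r00 : 0 <= r0 by apply: lb_le_inf => [|r []]; first by case: infS.
have fr0 x : 0 <= f x + r0 * n x.
  rewrite leNgt; apply/negP => neg.
  (* The infimum belongs to S: if the inequality failed for r0 at x, it would still fail for every r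
     < r0 + e. The summand 1 avoids a division by zero. *)
  pose e := - (f x + r0 * n x) / (n x + 1).
  have n1 : 0 < n x + 1 by rewrite ltr_wpDl.
  have e0 : 0 < e by rewrite divr_gt0 // oppr_gt0.
  have [r [_ /(_ x) fr] rr0] := inf_adherent e0 infS.
  have : f x + r * n x <= f x + (r0 + e) * n x.
    by rewrite lerD2l ler_wpM2r // ltW.
  move/(le_trans fr); rewrite mulrDl addrA => h.
  have : e * n x < - (f x + r0 * n x).
    by rewrite /e mulrAC ltr_pdivrMr // ltr_pM2l ?oppr_gt0 // ltrDl.
  by rewrite ltNge => /negP; apply; rewrite -subr_ge0 opprK addrC.
have [r0E|r0n0] := eqVneq r0 0.
  by move=> x; rewrite -fE lecR; have := fr0 x; rewrite r0E mul0r addr0.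
have r0p : 0 < r0 by rewrite lt0r r0n0.
have lp : 0 < r0%:C%C :> C by rewrite ltcR.
have [b bb bB] := Ainv _ lp; have [k k0 bk] := bounded_opE bb.
pose B x := A x + r0%:C%C *: x.
have rR : (r0%:C%C : C)^* = r0%:C%C by apply/CrealP; rewrite ger0_real // ltW.
have linB : linear B.
  move=> a x y; rewrite /B (opP linA) !scalerDr !scalerA [a * _]mulrC.
  by rewrite addrACA.
have BB x y : '[B x, y] = '[x, B y].
  by rewrite /B innerDl innerDr innerZl innerZr AA rR.
have B0 x : 0 <= '[B x, x].
  by rewrite /B innerDl innerZl inner_norm -fE -nE -rmorphM -rmorphD lecR.
pose m := c + r0%:C%C; have m0 : 0 < m by exact: addr_gt0.
have Bm x : `|B x| <= m * `|x|.
  by rewrite (le_trans (ler_normD _ _)) // mulrDl lerD // normrZ gtr0_norm.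
have mR : (m^-1)^* = m^-1 by apply/CrealP; rewrite realV ger0_real // ltW.
(* The inequality B^2 <= m B, from positivity of B at x - m^-1 B x and from <B (B x), B x> <= m |B
   x|^2. *)
have Bsq x : `|B x| ^+ 2 / m <= '[B x, x].
  have := B0 (x - m^-1 *: B x).
  rewrite (opB linB) (opZ linB) innerBl !innerBr !innerZl !innerZr mR.
  rewrite (BB (B x)) inner_norm.
  have : '[B (B x), B x] <= m * `|B x| ^+ 2.
    apply: le_trans (real_ler_norm (ger0_real (B0 _))) _.
    by rewrite (le_trans (inner_le _ _)) // expr2 mulrA ler_wpM2r.
  rewrite (BB (B x)) => h1 h2.
  have {h2} h3 : '[B x, x] >= 2 * (m^-1 * `|B x| ^+ 2) - m^-1 * (m^-1 * '[B x, B (B x)]).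
    by rewrite -subr_ge0; move: h2; congr (0 <= _); ring.
  apply: le_trans h3; rewrite -subr_ge0.
  have -> : 2 * (m^-1 * `|B x| ^+ 2) - m^-1 * (m^-1 * '[B x, B (B x)]) -
     `|B x| ^+ 2 / m = (m * `|B x| ^+ 2 - '[B x, B (B x)]) / m ^+ 2.
    by field; rewrite gt_eqF.
  by rewrite divr_ge0 ?exprn_ge0 ?subr_ge0 // ltW.
(* Left invertibility gives |x| <= k |B x|; together with [Bsq] this bounds B below by e. *)
pose e : C := (k ^+ 2 * m)^-1.
have e0 : 0 < e by rewrite invr_gt0 mulr_gt0 ?exprn_gt0.
have Be x : e * `|x| ^+ 2 <= '[B x, x].
  apply: le_trans (Bsq x); rewrite /e invfM mulrAC ler_wpM2r ?invr_ge0 ?(ltW m0) //.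
  rewrite mulrC ler_pdivrMr ?exprn_gt0 // mulrC -exprMn ler_pXn2r ?nnegrE //.
    by rewrite -{1}(bB x).
  by rewrite mulr_ge0 // ltW.
pose er := complex.Re e.
have erE : er%:C%C = e by rewrite ge0_ReC // ltW.
have er0 : 0 < er by rewrite -ltcR erE.
(* Subtracting at most er keeps the operator positive, and subtracting at most r0 keeps the shift
   nonnegative. *)
pose dr := Num.min r0 er.
have dr0 : 0 < dr by rewrite lt_min r0p er0.
have : S (r0 - dr).
  split=> [|x]; first by rewrite subr_ge0 ge_min lexx.
  have := Be x; rewrite /B innerDl innerZl inner_norm -fE -nE -erE.
  rewrite -!rmorphM -rmorphD lecR => h.
  rewrite mulrBl addrA subr_ge0; apply: le_trans h.
  by rewrite ler_wpM2r // ge_min lexx orbT.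
move/(inf_lbound infS.2); rewrite -/r0 => h.
by move: h; rewrite lerBrDl gerDr leNgt dr0.
Qed.

End PositiveOperators.

(** * Operator matrices and matrices over a von Neumann algebra *)

Section MatrixOperators.
Variables (R : realType) (H : hilbertType R) (I : finType).
Local Notation C := R[i].
Local Notation HI := (l2 I H).
Implicit Types (X Y : I -> I -> H -> H) (x : HI).

Definition entry (J : choiceType) (T : l2 J H -> l2 J H) (i j : J) : H -> H :=
  fun v => T (single j v) i.

Definition matrix_op Y : HI -> HI :=
  fun x => \sum_i single i (\sum_j Y i j (x j)).

Lemma sum_single (f : I -> H) i : (\sum_j single j (f j) : HI) i = f i.
Proof.
rewrite l2_sumE (bigD1 i) //= eqxx -[RHS]addr0; congr (_ + _).
by apply: big1 => j; rewrite eq_sym => /negbTE->.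
Qed.

Lemma l2_fin_sum x : x = \sum_j single j (x j).
Proof. by apply: l2_ext => i; rewrite sum_single. Qed.

Lemma matrix_opE Y x i : matrix_op Y x i = \sum_j Y i j (x j).
Proof. by rewrite sum_single. Qed.

Lemma l2_coord_le (J : choiceType) (x : l2 J H) j : `|x j| <= `|x|.
Proof.
rewrite -(@ler_pXn2r _ 2) ?nnegrE //.
by have := l2_sum_le x [fset j]%fset; rewrite big_seq_fset1.
Qed.

Lemma entry_bounded (J : choiceType) (T : l2 J H -> l2 J H) i j :
  bounded_operators _ T -> bounded_operators H (entry T i j).
Proof.
move=> bT; have [c c0 Tc] := bounded_opE bT.
apply: (@bounded_opI _ _ _ c) => [a v w|v]; rewrite /entry.
  by rewrite singleP (opP (bounded_op_lin bT)).
by rewrite (le_trans (l2_coord_le _ _)) // (le_trans (Tc _)) // norm_single.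
Qed.

Lemma entry_matrix_op Y i j : (forall i j, linear (Y i j)) ->
  entry (matrix_op Y) i j = Y i j.
Proof.
move=> linY; apply/funext => v; rewrite /entry matrix_opE (bigD1 j) //=.
rewrite eqxx big1 ?addr0 // => l /negbTE->.
by rewrite (op0 (linY i l)).
Qed.

Lemma op_entryE (T : HI -> HI) x i : linear T ->
  T x i = \sum_j entry T i j (x j).
Proof. by move=> linT; rewrite {1}(l2_fin_sum x) (op_sum linT) l2_sumE. Qed.

Lemma matrix_op_bounded Y : (forall i j, bounded_operators H (Y i j)) ->
  bounded_operators _ (matrix_op Y).
Proof.
move=> bY; have lin i j := bounded_op_lin (bY i j).
have /choice[c cP] (p : I * I) : exists c : C, 0 < c /\
    forall v, `|Y p.1 p.2 v| <= c * `|v|.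
  by have [c c0 Yc] := bounded_opE (bY p.1 p.2); exists c.
apply: (@bounded_opI _ _ _ (\sum_i \sum_j c (i, j))) => [a x y|x].
  apply: l2_ext => i; rewrite matrix_opE.
  have -> : (a *: matrix_op Y x + matrix_op Y y) i =
    a *: matrix_op Y x i + matrix_op Y y i by [].
  rewrite !matrix_opE scaler_sumr -big_split /=; apply: eq_bigr => j _.
  by rewrite -(opP (lin i j)).
rewrite (le_trans (ler_norm_sum _ _ _)) // mulr_suml ler_sum // => i _.
rewrite norm_single (le_trans (ler_norm_sum _ _ _)) // mulr_suml ler_sum // => j _.
have [cij Yc] := cP (i, j); rewrite (le_trans (Yc _)) //=.
by rewrite ler_wpM2l ?(ltW cij) // l2_coord_le.
Qed.

Lemma inner_fin x (y : HI) : '[x, y] = \sum_i '[x i, y i].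
Proof. by rewrite {1}(l2_fin_sum y) inner_sumr; apply: eq_bigr => i _; exact: inner_single. Qed.

Lemma inner_matrix_op Y x : '[matrix_op Y x, x] = \sum_i \sum_j '[Y i j (x j), x i].
Proof.
by rewrite inner_fin; apply: eq_bigr => i _; rewrite matrix_opE inner_suml.
Qed.

Lemma matrix_op_adjoint Y : (forall i j, bounded_operators H (Y i j)) ->
  is_adjoint (matrix_op Y) (matrix_op Y) <-> forall i j, is_adjoint (Y i j) (Y j i).
Proof.
move=> bY; have lin i j := bounded_op_lin (bY i j).
split=> [YY i j v w|YY x y].
  rewrite -{1}(entry_matrix_op i j lin) -(entry_matrix_op j i lin) /entry.
  by rewrite -inner_single YY inner_singlel.
rewrite !inner_fin.
under eq_bigr do rewrite matrix_opE inner_suml.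
under [RHS]eq_bigr do rewrite matrix_opE inner_sumr.
rewrite exchange_big; apply: eq_bigr => j _; apply: eq_bigr => i _.
exact: YY.
Qed.

End MatrixOperators.

Section VonNeumannAlgebras.
Variables (R : realType) (H : hilbertType R) (M : set (H -> H)).
Hypothesis vnM : von_neumann_algebra M.
Local Notation C := R[i].
Implicit Types (S T : H -> H).

Lemma vn_op0 : M 0.
Proof.
have := vn_linear vnM (-1) (vn_id vnM) (vn_id vnM).
by rewrite scaleN1r addNr.
Qed.

Lemma vn_opZ (a : C) T : M T -> M (a *: T).
Proof. by move=> MT; rewrite -[_ *: _]addr0; apply: vn_linear vn_op0. Qed.

Lemma vn_opD S T : M S -> M T -> M (S + T).
Proof. by move=> MS MT; rewrite -[S]scale1r; exact: vn_linear. Qed.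

Lemma vn_op_sum (I : Type) (r : seq I) (f : I -> H -> H) :
  (forall i, M (f i)) -> M (\sum_(i <- r) f i).
Proof. by move=> Mf; elim/big_ind : _ => //; [exact: vn_op0 | exact: vn_opD]. Qed.

Lemma vn_weakly_closed : weakly_closed M.
Proof.
move=> U UU S T c c0 MS linS Sc bT Tc ST; apply: (vn_closed vnM).
have PU : ProperFilter U by exact: ultra_proper.
exact: (ultraweak_closure_lim c0 MS linS Sc (bounded_op_lin bT) Tc ST).
Qed.

Variables (I : finType).

Definition matrices_over : set (l2 I H -> l2 I H) :=
  [set T | bounded_operators _ T /\ forall i j, M (entry T i j)].

Lemma matrices_over_id : matrices_over idfun.
Proof.
split=> [|i j]; first exact: bounded_op_id.
rewrite (_ : entry _ i j = if i == j then idfun else 0).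
  by case: eqP => _; [exact: vn_id | exact: vn_op0].
by apply/funext => v; rewrite /entry /=; case: eqP.
Qed.

Lemma matrices_over_linear (a : C) (S T : l2 I H -> l2 I H) :
  matrices_over S -> matrices_over T -> matrices_over (a *: S + T).
Proof.
move=> [bS MS] [bT MT]; split=> [|i j]; first exact: bounded_opP.
rewrite (_ : entry _ i j = a *: entry S i j + entry T i j) //.
exact: vn_linear.
Qed.

Lemma matrices_over0 : matrices_over 0.
Proof.
have := matrices_over_linear (-1) matrices_over_id matrices_over_id.
by rewrite scaleN1r addNr.
Qed.

Lemma matrices_over_comp (S T : l2 I H -> l2 I H) :
  matrices_over S -> matrices_over T -> matrices_over (S \o T).
Proof.
move=> [bS MS] [bT MT]; split=> [|i j]; first exact: bounded_op_comp.
rewrite (_ : entry _ i j = \sum_l (entry S i l \o entry T l j)).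
  by apply: vn_op_sum => l; exact: vn_comp.
apply/funext => v; rewrite fct_sumE /entry /=.
by rewrite (op_entryE _ _ (bounded_op_lin bS)).
Qed.

Lemma matrices_over_weakly_closed : weakly_closed matrices_over.
Proof.
move=> U UU S T c c0 MS linS Sc bT Tc ST; split=> // i j.
have cE (P : l2 I H -> l2 I H) : (forall x, `|P x| <= c * `|x|) ->
    forall v, `|entry P i j v| <= c * `|v|.
  by move=> Pc v; rewrite /entry (le_trans (l2_coord_le _ _)) // (le_trans (Pc _)) // norm_single.
apply: (vn_weakly_closed UU c0 (fun t => (MS t).2 i j) _ (fun t => cE _ (Sc t)) _ (cE _ Tc)).
- by move=> t; exact/bounded_op_lin/entry_bounded/(MS t).1.
- exact: entry_bounded.
- move=> v w; rewrite -inner_single.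
  have -> : (fun t => '[entry (S t) i j v, w]) =
      (fun t => '[S t (single j v), single i w]).
    by apply/funext => t; rewrite inner_single.
  exact: ST.
Qed.

Lemma matrix_op_over Y : (forall i j, M (Y i j)) -> matrices_over (matrix_op Y).
Proof.
move=> MY; have bY i j := vn_bounded vnM (MY i j).
split=> [|i j]; first exact: matrix_op_bounded.
by rewrite entry_matrix_op // => ? ?; exact: bounded_op_lin.
Qed.

End VonNeumannAlgebras.

Section StarAutomorphisms.
Variables (R : realType) (H : hilbertType R) (M : set (H -> H)).
Hypothesis vnM : von_neumann_algebra M.
Variable a : (H -> H) -> (H -> H).
Hypothesis saut : star_automorphism M a.
Local Notation C := R[i].
Implicit Types (S T : H -> H).

Lemma saut_in T : M T -> M (a T).
Proof. by have [aM _ _] := saut_bij saut; exact: aM. Qed.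

Lemma saut0 : a 0 = 0.
Proof.
have := saut_linear saut 1 (vn_op0 vnM) (vn_op0 vnM); rewrite !scale1r addr0.
by move/eqP; rewrite -subr_eq0 opprD addrA subrr sub0r oppr_eq0 => /eqP.
Qed.

Lemma sautD S T : M S -> M T -> a (S + T) = a S + a T.
Proof. by move=> MS MT; have := saut_linear saut 1 MS MT; rewrite !scale1r. Qed.

Lemma sautZ (c : C) T : M T -> a (c *: T) = c *: a T.
Proof.
by move=> MT; have := saut_linear saut c MT (vn_op0 vnM); rewrite saut0 !addr0.
Qed.

Lemma saut_sum (I : Type) (r : seq I) (f : I -> H -> H) :
  (forall i, M (f i)) -> a (\sum_(i <- r) f i) = \sum_(i <- r) a (f i).
Proof.
move=> Mf; elim: r => [|i r IHr]; first by rewrite !big_nil saut0.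
by rewrite !big_cons sautD ?IHr //; exact: vn_op_sum.
Qed.

(** Surjectivity gives T in M with a T = 1; then multiplicativity on T 1 = T reads a 1 = 1. *)
Lemma saut1 : a idfun = idfun.
Proof.
have [_ _ asurj] := saut_bij saut.
have [T MT aT] := asurj _ (vn_id vnM).
have := saut_comp saut MT (vn_id vnM).
by rewrite [T \o idfun](_ : _ = T) // aT => {2}->.
Qed.

Lemma saut_completely_positive (I : finType) (Y : I -> I -> H -> H) :
  (forall i j, M (Y i j)) ->
  (forall x : I -> H, 0 <= \sum_i \sum_j '[Y i j (x j), x i]) ->
  forall x : I -> H, 0 <= \sum_i \sum_j '[a (Y i j) (x j), x i].
Proof.
move=> MY Y0; have bY i j := vn_bounded vnM (MY i j).
have linY i j := bounded_op_lin (bY i j).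
have MaY i j : M (a (Y i j)) by exact/saut_in/MY.
have baY i j := vn_bounded vnM (MaY i j).
have linaY i j := bounded_op_lin (baY i j).
have [bmY MmY] := matrix_op_over vnM MY.
have mY0 x : 0 <= '[matrix_op Y x, x] by rewrite inner_matrix_op.
have /(matrix_op_adjoint bY) YY := positive_selfadjoint (bounded_op_lin bmY) mY0.
have aYY : is_adjoint (matrix_op (fun i j => a (Y i j))) (matrix_op (fun i j => a (Y i j))).
  by apply/(matrix_op_adjoint baY) => i j; exact: (saut_adjoint saut).
move=> x; pose z : l2 I H := \sum_j single j (x j).
have zE i : z i = x i by rewrite sum_single.
have := positive_of_left_inverses (matrix_op_bounded baY) aYY _ z.
rewrite inner_matrix_op.
have -> : \sum_i \sum_j '[a (Y i j) (z j), z i] =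
          \sum_i \sum_j '[a (Y i j) (x j), x i].
  by apply: eq_bigr => i _; apply: eq_bigr => j _; rewrite !zE.
apply=> l l0 {x z zE}.
have [b [bb Mb] bY1] := left_inverse_positive
  (fun P (MP : @matrices_over _ _ M I P) => MP.1)
  (@matrices_over0 _ _ _ vnM I) (@matrices_over_id _ _ _ vnM I)
  (@matrices_over_linear _ _ _ vnM I) (@matrices_over_comp _ _ _ vnM I)
  (@matrices_over_weakly_closed _ _ _ vnM I) (matrix_op_over vnM MY) mY0 l0.
pose D (i j : I) : H -> H := if i == j then idfun else 0.
have MD i j : M (D i j) by rewrite /D; case: eqP => _; [exact: vn_id|exact: vn_op0].
have aD i j : a (D i j) = D i j by rewrite /D; case: eqP => _; [exact: saut1|exact: saut0].
(* The relation b (Y + l) = 1 entry by entry, with D the identity matrix. Only finite sums and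
   composites inside M occur, so a can be applied to both sides. *)
have key i k : \sum_j (entry b i j \o (l *: D j k + Y j k)) = D i k.
  apply/funext => v; rewrite fct_sumE.
  have := congr1 (fun y : l2 I H => y i) (bY1 (single k v)).
  rewrite (op_entryE _ _ (bounded_op_lin bb)) singleE => e.
  have -> : D i k v = if i == k then v else 0 by rewrite /D; case: eqP.
  rewrite -e; apply: eq_bigr => j _.
  change (entry b i j ((l *: D j k + Y j k) v) = entry b i j
    ((matrix_op Y (single k v) + l *: single k v : l2 I H) j)).
  congr (entry b i j _).
  have -> : (matrix_op Y (single k v) + l *: single k v) j =
    entry (matrix_op Y) j k v + l *: single k v j by [].
  rewrite entry_matrix_op // singleE [RHS]addrC.
  have -> : (l *: D j k + Y j k) v = l *: D j k v + Y j k v by [].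
  by rewrite /D; case: eqP.
have akey i k : \sum_j (a (entry b i j) \o (l *: D j k + a (Y j k))) = D i k.
  rewrite -[RHS]aD -key saut_sum; last first.
    by move=> j; apply: vn_comp => //; exact: vn_linear.
  apply: eq_bigr => j _; rewrite (saut_comp saut) //; last exact: vn_linear.
  by rewrite (saut_linear saut) // aD.
have Mab i j : M (a (entry b i j)) by exact/saut_in/Mb.
have bab : bounded_operators _ (matrix_op (fun i j => a (entry b i j))).
  exact: (matrix_op_over vnM Mab).1.
exists (matrix_op (fun i j => a (entry b i j))); first exact: bab.
have linab i j := bounded_op_lin (vn_bounded vnM (Mab i j)).
have D_sum i (f : I -> H) : \sum_k D i k (f k) = f i.
  rewrite (bigD1 i) //= /D eqxx -[RHS]addr0; congr (_ + _).
  by apply: big1 => j; rewrite eq_sym => /negbTE->.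
move=> x; apply: l2_ext => i; rewrite matrix_opE -[RHS](D_sum i x).
have -> : \sum_k D i k (x k) =
    \sum_k \sum_j a (entry b i j) ((l *: D j k + a (Y j k)) (x k)).
  by apply: eq_bigr => k _; rewrite -akey fct_sumE.
rewrite exchange_big; apply: eq_bigr => j _.
rewrite -(op_sum (linab i j)); congr (a (entry b i j) _).
change (matrix_op (fun i j => a (Y i j)) x j + l *: x j =
  \sum_k (l *: D j k (x k) + a (Y j k) (x k))).
rewrite matrix_opE -(D_sum j x) scaler_sumr -big_split; apply: eq_bigr => k _.
by rewrite addrC.
Qed.

(** The bound |T| <= c says that c^2 - T* T is positive. This operator lies in M, so
    [saut_completely_positive] for 1 x 1 matrices transports its positivity. *)
Lemma saut_norm T (c : C) : M T -> (forall x, `|T x| <= c * `|x|) -> 0 < c ->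
  forall x, `|a T x| <= c * `|x|.
Proof.
move=> MT Tc c0 x; have bT := vn_bounded vnM MT.
have [S bS TS] := adjoint_ex bT; have MS := vn_adjoint vnM MT TS.
pose Y : H -> H := c ^+ 2 *: idfun + (-1) *: (S \o T).
have M2 := vn_opZ vnM (c ^+ 2) (vn_id vnM).
have MST := vn_comp vnM MS MT.
have MY : M Y := vn_opD vnM M2 (vn_opZ vnM _ MST).
have YE y : Y y = c ^+ 2 *: y + (-1) *: S (T y) by [].
have aYE y : a Y y = c ^+ 2 *: y + (-1) *: a S (a T y).
  have -> : a Y = c ^+ 2 *: idfun + (-1) *: (a S \o a T).
    rewrite /Y (sautD M2 (vn_opZ vnM _ MST)) (sautZ _ (vn_id vnM)) saut1.
    by rewrite (sautZ _ MST) (saut_comp saut MS MT).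
  by [].
have := @saut_completely_positive 'I_1 (fun _ _ => Y) (fun _ _ => MY) _ (fun=> x).
rewrite !big_ord1 aYE innerDl !innerZl mulN1r.
rewrite (adjoint_sym (saut_adjoint saut MT MS TS)) !inner_norm => h.
rewrite -(@ler_pXn2r _ 2) ?nnegrE ?mulr_ge0 ?(ltW c0) // exprMn -subr_ge0.
apply: h => y; rewrite !big_ord1 YE innerDl !innerZl mulN1r.
rewrite (adjoint_sym TS) !inner_norm subr_ge0 -exprMn.
by rewrite ler_pXn2r ?nnegrE ?mulr_ge0 ?(ltW c0).
Qed.

End StarAutomorphisms.

(** * Crossed products *)

Section Shift.
Variables (R : realType) (G : groupType) (K : hilbertType R).
Local Notation C := R[i].
Implicit Types (g h : G) (x y : l2 G K).

Fact shift_subproof g x :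
  (fun h => x (g^-1 * h)%g) \in @square_summable R G K.
Proof.
apply/asboolP; exists (`|x| ^+ 2) => A.
apply: le_trans (l2_sum_le x [fset (g^-1 * h)%g | h in A]%fset).
rewrite big_imfset //= => h h' _ _; exact: mulgI.
Qed.
(** Serves for lambda_g, with K = C, and for L_g, with K = H. *)
Definition shift g x : l2 G K := L2 (shift_subproof g x).

Lemma shiftE g x h : shift g x h = x (g^-1 * h)%g.
Proof. by []. Qed.

Lemma shift_single g h v : shift g (single h v) = single (g * h)%g v.
Proof.
by apply: l2_ext => j; rewrite shiftE !singleE (can2_eq (mulVKg g) (mulKg g)).
Qed.

Lemma shift_bounded g : bounded_operators _ (shift g).
Proof.
apply: (@bounded_opI _ _ _ 1) => [a x y|x]; first exact: l2_ext.
rewrite mul1r; apply: l2_norm_le => // A.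
apply: le_trans (l2_sum_le x [fset (g^-1 * h)%g | h in A]%fset).
rewrite big_imfset //= => h h' _ _; exact: mulgI.
Qed.

Lemma shift_adjoint g : is_adjoint (shift g) (shift g^-1).
Proof.
have [S bS gS] := adjoint_ex (shift_bounded g).
suff -> : shift g^-1 = S by [].
apply/funext => x; apply: l2_ext => h; rewrite shiftE invgK.
apply: inner_ext => v.
by rewrite innerC -inner_singlel -shift_single gS inner_singlel -innerC.
Qed.

Lemma shift1 : shift 1 = idfun.
Proof. by apply/funext => x; apply: l2_ext => h; rewrite shiftE invg1 mul1g. Qed.

End Shift.

Section CrossedOperators.
Variables (R : realType) (G : groupType) (H : hilbertType R).
Local Notation C := R[i].
Local Notation l2G := (l2 G C).
Local Notation Hl2G := (l2 G H).
Implicit Types (g h : G).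

Lemma tensor_delta (v : H) g : tensor v (delta R g) = single g v.
Proof.
apply: l2_ext => h; rewrite singleE /=; case: eqP => _; first exact: scale1r.
exact: scale0r.
Qed.

Lemma single_delta (c : C) g : single g c = c *: delta R g.
Proof.
apply: l2_ext => h; rewrite singleE.
have -> : (c *: delta R g) h = c * (h == g)%:R by [].
by case: eqP; rewrite ?mulr1 ?mulr0.
Qed.

Lemma op_ext_delta (S T : l2G -> l2G) :
  bounded_operators _ S -> bounded_operators _ T ->
  (forall g, S (delta R g) = T (delta R g)) -> S = T.
Proof.
move=> bS bT ST; apply: op_ext_single => // g c; rewrite single_delta.
by rewrite (opZ (bounded_op_lin bS)) (opZ (bounded_op_lin bT)) ST.
Qed.

(** The operator chosen by [get] and the explicit one satisfy the same description, which determines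
    a bounded operator by its values on the [delta]s. The other operators defined by [get] are made
    explicit by similar uniqueness arguments. *)
Lemma translationE g : @translation R G g = shift g.
Proof.
rewrite /translation; set P := [set T | _].
have P_shift : P (shift g).
  split=> [|h]; first exact: shift_bounded.
  rewrite -[delta R h]scale1r -single_delta shift_single single_delta.
  exact: scale1r.
have [bT Tdelta] : P (get P) by apply: getPex; exists (shift g).
apply: op_ext_delta => // [|h]; first exact: shift_bounded.
by rewrite Tdelta P_shift.2.
Qed.

Lemma tensor_opE (S : H -> H) (T : l2G -> l2G) (V : Hl2G -> Hl2G) :
  bounded_operators _ V ->
  (forall v f, V (tensor v f) = tensor (S v) (T f)) -> tensor_op S T = V.
Proof.
move=> bV VP; rewrite /tensor_op; set P := [set U | _].
have [bU UP] : P (get P) by apply: getPex; exists V; split.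
by apply: op_ext_single => // g v; rewrite -tensor_delta UP VP.
Qed.

Lemma LopE g : Lop H g = shift g.
Proof.
rewrite /Lop translationE; apply: tensor_opE => [|v f].
  exact: shift_bounded.
exact: l2_ext.
Qed.

(** The operator S (x) e_(g,g). *)
Definition coord_op (K : hilbertType R) g (S : K -> K) : l2 G K -> l2 G K :=
  fun x => single g (S (x g)).

Lemma coord_op_bounded (K : hilbertType R) g (S : K -> K) :
  bounded_operators K S -> bounded_operators _ (@coord_op K g S).
Proof.
move=> bS; have [c c0 Sc] := bounded_opE bS.
apply: (@bounded_opI _ _ _ c) => [a x y|x].
  rewrite /coord_op -singleP -(opP (bounded_op_lin bS)).
  by [].
rewrite /coord_op norm_single (le_trans (Sc _)) // ler_wpM2l ?(ltW c0) //.
exact: l2_coord_le.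
Qed.

Lemma matrix_unitE g : @matrix_unit R G g g = @coord_op C g idfun.
Proof.
rewrite /matrix_unit; set P := [set T | _].
have PV : P (@coord_op C g idfun).
  split=> [|h]; first by apply: coord_op_bounded; exact: bounded_op_id.
  rewrite /coord_op single_delta /= eq_sym; case: eqP => _; first exact: scale1r.
  exact: scale0r.
have [bT Tdelta] : P (get P) by apply: getPex; exists (@coord_op C g idfun).
apply: op_ext_delta => // [|h]; first exact: PV.1.
by rewrite Tdelta PV.2.
Qed.

Lemma tensor_op_unit g (S : H -> H) : bounded_operators H S ->
  tensor_op S (@matrix_unit R G g g) = @coord_op H g S.
Proof.
move=> bS; rewrite matrix_unitE; apply: tensor_opE => [|v f].
  exact: coord_op_bounded.
apply: l2_ext => h; rewrite /coord_op singleE /=.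
rewrite (opZ (bounded_op_lin bS)).
by case: eqP => // _; rewrite scale0r.
Qed.

Variables (M : set (H -> H)) (alpha : G -> (H -> H) -> (H -> H)).
Hypothesis vnM : von_neumann_algebra M.
Hypothesis act : action_on M alpha.
Implicit Types (r s : H -> H).

Lemma act_in g r : M r -> M (alpha g r).
Proof. exact: saut_in (action_saut act g) _. Qed.

Lemma act_bounded g r : M r -> bounded_operators H (alpha g r).
Proof. by move=> Mr; apply: (vn_bounded vnM); exact: act_in. Qed.

(** By [saut_norm] all alpha_(h^-1)(r) share the bound c of r, so they are the coordinates of a
    bounded diagonal operator D. The partial sums defining Psi at x are the truncations of D x. *)
Lemma PsiP r : M r -> bounded_operators _ (Psi alpha r) /\
  forall x h, Psi alpha r x h = alpha h^-1%g r (x h).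
Proof.
move=> Mr; have [c c0 rc] := bounded_opE (vn_bounded vnM Mr).
have lin g := bounded_op_lin (act_bounded g Mr).
have [D [bD _ DE]] := @diag_op R G H (fun h => alpha h^-1%g r) c (ltW c0)
  (fun h => lin _) (fun h => saut_norm vnM (action_saut act _) Mr rc c0).
suff -> : Psi alpha r = D by [].
rewrite /Psi; set P := [set T | _].
have PD : P D.
  split=> // x B /(@cvg_trunc _ _ _ (D x)) DB.
  have sumE (A : {fset G}) :
      \sum_(g <- A) tensor_op (alpha g^-1%g r) (@matrix_unit R G g g) x =
      trunc A (D x).
    apply: eq_bigr => g _.
    by rewrite tensor_op_unit ?DE //; exact: act_bounded.
  suff : @summability.totally G (fun A : {fset G} =>
    B (\sum_(g <- A) tensor_op (alpha g^-1%g r) (@matrix_unit R G g g) x)) by [].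
  by apply: (@filterS _ (@summability.totally G) _ _ _ _ DB) => A; rewrite sumE.
have [bT TP] : P (get P) by apply: getPex; exists D.
apply/funext => x.
exact: (cvg_unique (@norm_hausdorff _ Hl2G) (TP x) (PD.2 x)).
Qed.

Lemma Psi_bounded r : M r -> bounded_operators _ (Psi alpha r).
Proof. by move=> /PsiP[]. Qed.

Lemma PsiE r x h : M r -> Psi alpha r x h = alpha h^-1%g r (x h).
Proof. by move=> /PsiP[]. Qed.

Lemma Psi_linear (a : C) r s : M r -> M s ->
  Psi alpha (a *: r + s) = a *: Psi alpha r + Psi alpha s.
Proof.
move=> Mr Ms; apply/funext => x; apply: l2_ext => h.
rewrite PsiE; last exact: vn_linear.
rewrite (saut_linear (action_saut act _)) //.
have -> : (a *: Psi alpha r + Psi alpha s) x h =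
  a *: Psi alpha r x h + Psi alpha s x h by [].
by rewrite !PsiE.
Qed.

Lemma Psi0 : Psi alpha 0 = 0.
Proof.
apply/funext => x; apply: l2_ext => h; rewrite PsiE; last exact: vn_op0.
by rewrite (saut0 vnM (action_saut act _)).
Qed.

Lemma Psi1 : Psi alpha idfun = idfun.
Proof.
apply/funext => x; apply: l2_ext => h; rewrite PsiE; last exact: vn_id.
by rewrite (saut1 vnM (action_saut act _)).
Qed.

Lemma Psi_comp r s : M r -> M s -> Psi alpha (r \o s) = Psi alpha r \o Psi alpha s.
Proof.
move=> Mr Ms; apply/funext => x; apply: l2_ext => h.
rewrite PsiE; last exact: vn_comp.
by rewrite (saut_comp (action_saut act _)) //= !PsiE.
Qed.

Lemma Psi_adjoint r s : M r -> is_adjoint r s ->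
  is_adjoint (Psi alpha r) (Psi alpha s).
Proof.
move=> Mr rs x y; have Ms := vn_adjoint vnM Mr rs.
rewrite !l2_innerE; congr usum; apply/funext => h; rewrite !PsiE //.
exact: (saut_adjoint (action_saut act _)).
Qed.

(** The form of the matrix Psi(Y i j) is a limit of finite sums over h of the forms of
    alpha_(h^-1)(Y i j), each of them nonnegative. *)
Lemma Psi_completely_positive (I : finType) (Y : I -> I -> H -> H) :
  (forall i j, M (Y i j)) ->
  (forall v : I -> H, 0 <= \sum_i \sum_j '[Y i j (v j), v i]) ->
  forall x : I -> Hl2G, 0 <= \sum_i \sum_j '[Psi alpha (Y i j) (x j), x i].
Proof.
move=> MY Y0 x.
apply: (@cvgC_ge0 _ _ (@summability.totally G) _ (fun A => \sum_i \sum_j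
    \sum_(h <- A) '[Psi alpha (Y i j) (x j) h, x i h])).
  by apply: cvgC_sum => i; apply: cvgC_sum => j; exact: l2_cvg_inner.
move=> A; under eq_bigr do rewrite exchange_big.
rewrite exchange_big; apply: sumr_ge0 => h _.
have := saut_completely_positive vnM (action_saut act h^-1%g) MY Y0 (fun i => x i h).
congr (0 <= _); apply: eq_bigr => i _; apply: eq_bigr => j _.
by rewrite PsiE.
Qed.

(** Covariance: Psi(alpha_h(r)) = L_h Psi(r) L_h^-1. *)
Lemma Lop_Psi_conj g h r : M r ->
  Lop H (g * h^-1)%g \o Psi alpha (alpha h r) =
  shift g \o Psi alpha r \o shift h^-1%g.
Proof.
move=> Mr; apply/funext => x; apply: l2_ext => j /=.
rewrite LopE !shiftE !PsiE //; last exact: act_in.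
rewrite -(action_mul act) // shiftE invgK !invgM !invgK !mulgA.
by rewrite mulgVK.
Qed.

End CrossedOperators.

Section Span.
Variables (R : realType) (K : hilbertType R) (A : set (K -> K)).
Local Notation C := R[i].
Implicit Types (S T : K -> K).

Lemma span_of_incl T : A T -> span_of A T.
Proof.
by move=> AT; exists 1, (fun=> 1), (fun=> T); split=> //; rewrite big_ord1 scale1r.
Qed.

Lemma span_of0 : span_of A 0.
Proof. by exists 0, (fun=> 0), (fun=> 0); split=> [[]//|]; rewrite big_ord0. Qed.

Lemma span_ofZ (a : C) T : span_of A T -> span_of A (a *: T).
Proof.
move=> [n [c [S [AS ->]]]]; exists n, (fun i => a * c i), S; split=> //.
by rewrite scaler_sumr; apply: eq_bigr => i _; rewrite scalerA.
Qed.

Lemma span_ofD S T : span_of A S -> span_of A T -> span_of A (S + T).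
Proof.
move=> [n [c [P [AP ->]]]] [m [d [Q [AQ ->]]]].
exists (n + m)%N, (fun i => match fintype.split i with inl j => c j | inr j => d j end),
  (fun i => match fintype.split i with inl j => P j | inr j => Q j end).
split=> [i|]; first by case: fintype.split.
rewrite big_split_ord /=; congr (_ + _); apply: eq_bigr => i _.
  by rewrite -[lshift m i]/(unsplit (inl i)) unsplitK.
by rewrite -[rshift n i]/(unsplit (inr i)) unsplitK.
Qed.

Lemma span_of_sum (I : Type) (r : seq I) (f : I -> K -> K) :
  (forall i, span_of A (f i)) -> span_of A (\sum_(i <- r) f i).
Proof. by move=> Af; elim/big_ind : _ => //; [exact: span_of0 | exact: span_ofD]. Qed.

Lemma span_of_bounded :
  A `<=` bounded_operators K -> span_of A `<=` bounded_operators K.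
Proof.
move=> bA _ [n [c [S [AS ->]]]]; apply: bounded_op_sum => i.
exact/bounded_opZ/bA/AS.
Qed.

End Span.

Section FsetSums.
Variables (T : choiceType) (R : nzRingType) (V : lmodType R) (F : {fset T}).

Lemma sum_fset_if_eq (u : T) (v : V) :
  \sum_(t <- F) (if t == u then v else 0) = if u \in F then v else 0.
Proof.
case: ifP => uF.
  rewrite (big_fsetD1 u uF) /= eqxx -[RHS]addr0; congr (_ + _).
  by rewrite big_seq big1 // => t; rewrite !inE => /andP[/negbTE->].
by rewrite big_seq big1 // => t tF; case: eqP => // tu; rewrite -tu tF in uF.
Qed.

Lemma sum_fset_if (P : pred T) (v : V) :
  \sum_(t <- F) (if P t then v else 0) =
  #|` [fset t in F | P t]%fset|%:R *: v.
Proof.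
rewrite -big_mkcond big_fset_condE card_fset_sum1 natr_sum scaler_suml.
by apply: eq_bigr => t _; rewrite scale1r.
Qed.

End FsetSums.

Lemma sum_pair (I J : finType) (V : nmodType) (f : I * J -> V) :
  \sum_p f p = \sum_i \sum_j f (i, j).
Proof. by rewrite pair_bigA; apply: eq_bigr => -[]. Qed.

(** * The averaging map of a finite set *)

Section Averages.
Variables (R : realType) (G : groupType) (H : hilbertType R).
Local Notation C := R[i].
Local Notation Hl2G := (l2 G H).
Variables (M : set (H -> H)) (alpha : G -> (H -> H) -> (H -> H)).
Hypothesis vnM : von_neumann_algebra M.
Hypothesis act : action_on M alpha.
Implicit Types (r s : H -> H) (x : Hl2G -> Hl2G).

Definition algebraic_crossed_product : set (Hl2G -> Hl2G) :=
  span_of [set T | exists g r, M r /\ T = Lop H g \o Psi alpha r].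

Lemma algebraic_crossed_product_bounded :
  algebraic_crossed_product `<=` bounded_operators _.
Proof.
apply: span_of_bounded => _ [g [r [Mr ->]]]; rewrite LopE.
by apply: bounded_op_comp (Psi_bounded vnM act Mr); exact: shift_bounded.
Qed.

Variables (E : (H -> H) -> (H -> H)).
Hypothesis ucpE : ucp_into M E.
Hypothesis Eid : forall T, M T -> E T = T.
Variable F : {fset G}.
Hypothesis F0 : (0 < #|` F|)%N.

Definition overlap (g : G) : C :=
  #|` [fset h in F | (g^-1 * h)%g \in F]%fset|%:R / #|` F|%:R.

Lemma overlap1 : overlap 1%g = 1.
Proof.
rewrite /overlap; have -> : [fset h in F | (1^-1 * h)%g \in F]%fset = F.
  by apply/fsetP => h; rewrite !inE invg1 mul1g andbb.
by rewrite divff // pnatr_eq0 -lt0n.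
Qed.

(** Written with each term of the shape L_u Psi(s), so that membership in the span is visible. The
    symmetric form [averageE], equal to it by covariance, is the one that shows positivity. *)
Definition average x : Hl2G -> Hl2G := #|` F|%:R^-1 *:
  \sum_(g <- F) \sum_(h <- F)
    (Lop H (g * h^-1)%g \o Psi alpha (alpha h (E (entry x g h)))).

Let ME x g h : bounded_operators _ x -> M (E (entry x g h)).
Proof. by move=> bx; apply: (ucp_range ucpE); exact: entry_bounded. Qed.

Lemma averageE x : bounded_operators _ x -> average x = #|` F|%:R^-1 *:
  \sum_(g <- F) \sum_(h <- F)
    (shift g \o Psi alpha (E (entry x g h)) \o shift h^-1%g).
Proof.
move=> bx; congr (_ *: _); apply: eq_bigr => g _; apply: eq_bigr => h _.
by rewrite (Lop_Psi_conj vnM act) //; exact: ME.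
Qed.

Lemma E0 : E 0 = 0. Proof. by apply: Eid; exact: vn_op0. Qed.

(** The (u, v) entry of L_g Psi(r) is alpha_(v^-1)(r) if u = g v and 0 otherwise. E fixes it,
    alpha_v undoes alpha_(v^-1), and u v^-1 = g, so each such pair in F x F contributes L_g Psi(r)
    once. *)
Lemma average_Lop_Psi g r : M r ->
  average (Lop H g \o Psi alpha r) = overlap g *: (Lop H g \o Psi alpha r).
Proof.
move=> Mr; rewrite /average /overlap [_ / _]mulrC -scalerA; congr (_ *: _).
have termE u v : Lop H (u * v^-1)%g \o
    Psi alpha (alpha v (E (entry (Lop H g \o Psi alpha r) u v))) =
    if v == (g^-1 * u)%g then Lop H g \o Psi alpha r else 0.
  have -> : entry (Lop H g \o Psi alpha r) u v =
      if v == (g^-1 * u)%g then alpha v^-1%g r else 0.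
    apply/funext => w; rewrite /entry /= LopE shiftE (PsiE vnM act) // singleE eq_sym.
    case: eqP => [<-//|_].
    by rewrite (op0 (bounded_op_lin (act_bounded vnM act _ Mr))).
  case: eqP => [vE|_].
    rewrite Eid; last exact: (act_in act).
    rewrite -(action_mul act) // mulgV (action_one act) //.
    by rewrite vE invgM invgK mulgA mulgV mul1g.
  rewrite E0 (saut0 vnM (action_saut act v)) (Psi0 vnM act).
  apply/funext => x /=; rewrite LopE.
  exact: (op0 (bounded_op_lin (shift_bounded _ _))).
under eq_bigr do under eq_bigr do rewrite termE.
by under eq_bigr do rewrite sum_fset_if_eq; rewrite sum_fset_if.
Qed.

Lemma Lop1 : Lop H (1%g : G) = idfun.
Proof. by rewrite LopE shift1. Qed.

Lemma average_ucp : ucp_into algebraic_crossed_product average.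
Proof.
have c0 : 0 < #|` F|%:R :> C by rewrite ltr0n.
split.
- move=> x bx; apply/span_ofZ/span_of_sum => g; apply: span_of_sum => h.
  apply: span_of_incl; exists (g * h^-1)%g, (alpha h (E (entry x g h))).
  by split=> //; apply: (act_in act); exact: ME.
- move=> a x y bx by_; have bxy := bounded_opP a bx by_.
  rewrite !averageE // scalerA mulrC -scalerA -scalerDr; congr (_ *: _).
  rewrite scaler_sumr -big_split; apply: eq_bigr => g _ /=.
  rewrite scaler_sumr -big_split; apply: eq_bigr => h _ /=.
  have -> : entry (a *: x + y) g h = a *: entry x g h + entry y g h by [].
  rewrite (ucp_linear ucpE) ?(Psi_linear vnM act); try exact: ME;
    try exact: entry_bounded.
  apply/funext => z /=.
  have -> : (a *: (shift g \o Psi alpha (E (entry x g h)) \o shift h^-1%g) +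
    (shift g \o Psi alpha (E (entry y g h)) \o shift h^-1%g)) z =
    a *: shift g (Psi alpha (E (entry x g h)) (shift h^-1%g z)) +
    shift g (Psi alpha (E (entry y g h)) (shift h^-1%g z)) by [].
  by rewrite -(opP (bounded_op_lin (shift_bounded _ g))).
- have := average_Lop_Psi 1%g (vn_id vnM).
  by rewrite overlap1 scale1r Lop1 (Psi1 vnM act).
- move=> n X bX X0 x.
  (* Compressing every X i j to the coordinates in F gives a positive matrix over B(H) indexed by J.
     E and then Psi keep it positive, and testing on the vectors L_(g^-1) x_i recovers the form of
     the averages. *)
  pose J : finType := ('I_n * F)%type.
  pose Y (p q : J) := entry (X p.1 q.1) (val p.2) (val q.2).
  have bY p q : bounded_operators H (Y p q) by exact: entry_bounded.
  have Y0 (v : J -> H) : 0 <= \sum_p \sum_q '[Y p q (v q), v p].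
    pose z i : Hl2G := \sum_(h : F) single (val h) (v (i, h)).
    have := X0 z; congr (0 <= _); rewrite [RHS]sum_pair; apply: eq_bigr => i _.
    under [RHS]eq_bigr do rewrite sum_pair.
    rewrite [RHS]exchange_big; apply: eq_bigr => j _.
    rewrite (op_sum (bounded_op_lin (bX i j))) inner_sumr; apply: eq_bigr => g _.
    by rewrite inner_suml; apply: eq_bigr => h _; rewrite inner_single.
  have := Psi_completely_positive vnM act (fun p q => ucp_range ucpE (bY p q))
    (ucp_positive_fin ucpE bY Y0) (fun p => shift (val p.2)^-1%g (x p.1)).
  have c1 : 0 < #|` F|%:R^-1 :> C by rewrite invr_gt0.
  rewrite -(pmulr_rge0 _ c1); congr (0 <= _).
  rewrite sum_pair mulr_sumr; apply: eq_bigr => i _.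
  under eq_bigr do rewrite sum_pair.
  rewrite exchange_big mulr_sumr; apply: eq_bigr => j _.
  rewrite averageE // -[RHS]/('[#|` F|%:R^-1 *: (_ : Hl2G -> Hl2G) (x j), x i]).
  rewrite innerZl fct_sumE inner_suml big_seq_fsetE; congr (_ * _).
  apply: eq_bigr => g _; rewrite fct_sumE inner_suml big_seq_fsetE.
  by apply: eq_bigr => h _; rewrite /= shift_adjoint.
Qed.


End Averages.

Section Multipliers.
Variables (R : realType) (G : groupType) (H : hilbertType R).
Local Notation C := R[i].
Variables (M : set (H -> H)) (alpha : G -> (H -> H) -> (H -> H)).
Hypothesis vnM : von_neumann_algebra M.
Hypothesis injM : injective_algebra M.
Hypothesis act : action_on M alpha.

(** Any group with nonempty finite sets whose overlaps converge pointwise qualifies; along a Folner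
    sequence chi is constantly 1. *)
Lemma crossed_product_multiplier (F : nat -> {fset G}) (chi : G -> C) :
  (forall n, 0 < #|` F n|)%N ->
  (forall g, overlap R (F n) g @[n --> \oo] --> chi g) ->
  exists sigma : (l2 G H -> l2 G H) -> (l2 G H -> l2 G H),
    [/\ ucp_into (crossed_product M alpha) sigma,
        forall r s x, M r -> M s -> bounded_operators _ x ->
          sigma (Psi alpha r \o x \o Psi alpha s) =
          Psi alpha r \o sigma x \o Psi alpha s
      & forall g r, M r ->
          sigma (Lop H g \o Psi alpha r) = chi g *: (Lop H g \o Psi alpha r)].
Proof.
move=> F0 Fchi; have [E ucpE Eid] := injM.
have [U [UU Uoo]] := ultraFilterLemma (@eventually_filter).
have PU : ProperFilter U by exact: ultra_proper.
have bA := algebraic_crossed_product_bounded vnM act.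
have [sigma [ucps slim]] := @ucp_ultralimit _ _ _ nat U UU bA _
  (fun n => average_ucp vnM act ucpE Eid (F0 n)).
have bLP g r : M r -> bounded_operators _ (Lop H g \o Psi alpha r).
  move=> Mr; rewrite LopE.
  by apply: bounded_op_comp (Psi_bounded vnM act Mr); exact: shift_bounded.
have sLP g r : M r ->
    sigma (Lop H g \o Psi alpha r) = chi g *: (Lop H g \o Psi alpha r).
  move=> Mr; apply/funext => x; apply: inner_ext => y.
  apply: (cvgC_unique (slim _ (bLP g r Mr) x y)).
  have -> : (fun n => '[average alpha E (F n) (Lop H g \o Psi alpha r) x, y]) =
      (fun n => '[(Lop H g \o Psi alpha r) x, y] * overlap R (F n) g).
    apply/funext => n; rewrite (average_Lop_Psi vnM act Eid) // mulrC -innerZl.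
    by [].
  have -> : '[(chi g *: (Lop H g \o Psi alpha r)) x, y] =
     '[(Lop H g \o Psi alpha r) x, y] * chi g by rewrite mulrC -innerZl.
  by apply: cvgC_Z; apply: cvg_trans (Fchi g); apply: cvg_app.
have sPsi r : M r -> sigma (Psi alpha r) = Psi alpha r.
  move=> Mr; have := sLP 1%g r Mr; rewrite Lop1.
  suff -> : chi 1%g = 1 by rewrite scale1r.
  apply: (cvgC_unique (Fchi 1%g)).
  have -> : (fun n => overlap R (F n) 1%g) = fun=> 1.
    by apply/funext => n; rewrite overlap1.
  exact: cvg_cst.
have bN : crossed_product M alpha `<=` bounded_operators _ by move=> T [].
exists sigma; split=> // r s x Mr Ms bx.
have bPsi := Psi_bounded vnM act.
have [r' _ rr'] := adjoint_ex (vn_bounded vnM Mr).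
have [s' _ ss'] := adjoint_ex (vn_bounded vnM Ms).
have Mr' := vn_adjoint vnM Mr rr'; have Ms' := vn_adjoint vnM Ms ss'.
(* Psi(M) is closed under products and adjoints and is fixed by sigma, hence lies in its
   multiplicative domain: Psi s is taken out on the right of Psi r x, then Psi r on the left of
   x. *)
rewrite (ucp_mulr ucps bN (bPsi _ Ms) (Psi_adjoint vnM act Ms ss')
  (sPsi _ Ms) (sPsi _ Ms')); last first.
- by apply: bounded_op_comp bx; exact: bPsi.
- by rewrite -(Psi_comp vnM act) // sPsi //; exact: vn_comp.
rewrite (ucp_mull ucps bN (bPsi _ Mr) (Psi_adjoint vnM act Mr rr')
  (sPsi _ Mr) (sPsi _ Mr')) //.
by rewrite -(Psi_comp vnM act) // sPsi //; exact: vn_comp.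
Qed.

End Multipliers.

Theorem mainTheorem5 (R : realType) (k : nat) (hk : (2 <= k)%N) :
  (forall t : free_group k, chi_ball R n t @[n --> \oo] --> chi R t) /\
  (forall (H : hilbertType R) (M : set (H -> H))
      (alpha : free_group k -> (H -> H) -> (H -> H)),
    von_neumann_algebra M -> injective_algebra M -> action_on M alpha ->
    exists sigma : (l2 (free_group k) H -> l2 (free_group k) H) ->
                   (l2 (free_group k) H -> l2 (free_group k) H),
      [/\ ucp_into (crossed_product M alpha) sigma,
          forall r s x, M r -> M s ->
            bounded_operators _ x ->
            sigma (Psi alpha r \o x \o Psi alpha s) =
            Psi alpha r \o sigma x \o Psi alpha s
        & forall g r, M r ->
            sigma (Lop H g \o Psi alpha r) =
            ((chi R g)%:C)%C *: (Lop H g \o Psi alpha r)]).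
Proof.
have chi_cvg t := @cvg_chi_ball R k t hk; split=> // H M alpha vnM injM act.
apply: (@crossed_product_multiplier _ _ _ _ _ vnM injM act
  (fun n => fset_set (@word_ball k n)) (fun g => (chi R g)%:C%C)) => [n|g].
  by rewrite card_word_ball.
have -> : (fun n => overlap R (fset_set (@word_ball k n)) g) =
    (fun n => (chi_ball R n g)%:C%C).
  apply/funext => n; rewrite /overlap card_ball_overlap /chi_ball.
  by rewrite fmorph_div !rmorph_nat.
(* Convergence is transported along the embedding of the reals into C, where a positive e is its own
   real part. *)
apply/cvgrPdist_lt => e e0.
have er : 0 < complex.Re e by rewrite -ltcR ge0_ReC // ltW.
have /cvgrPdist_lt/(_ _ er) := chi_cvg g; apply: filterS => n.
by rewrite -rmorphB normC_real -{2}(ge0_ReC (ltW e0)) ltcR.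
Qed.
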